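(* Let $X_1,\dots,X_n\in\mathbb{R}^p$ and $Y_1,\dots,Y_n\in\mathbb{R}^p$ be random vectors satisfying the standing assumptions listed in the context, let $D$ be a deterministic $n\times n$ diagonal matrix with positive diagonal entries $R_1,\dots,R_n$, let $A$ be a deterministic positive definite $p\times p$ matrix with $A\succeq t\,\mathrm{Id}_p$ for some $t>0$, and let $\Sigma_\varepsilon$ be a deterministic positive semidefinite $p\times p$ matrix. For a deterministic $\alpha\in\mathbb{R}^n$ with $\|\alpha\|=1$ let, with $M=X^\top D^2X/n+A$, $$G(\alpha;X)=\alpha^\top\frac{DX}{\sqrt n}M^{-1}\Sigma_\varepsilon M^{-1}\frac{X^\top D}{\sqrt n}\alpha ,$$ define $G(\alpha;Y)$ in the same way with $Y$ in place of $X$, and let $b(A;\Sigma_\varepsilon)=\|A^{-1/2}\Sigma_\varepsilon A^{-1/2}\|_{op}$. Then, for a constant $K$, $\mathrm{var}(G(\alpha;X))\le\sum_{i=1}^nV_i$ with $$\begin{aligned}V_i\le K\,b^2(A;\Sigma_\varepsilon)\Big\{&\alpha_i^4\Big[\frac{R_i^4}{n^2}\frac{b_{Q_2}(2;X_i)}{t^2}\wedge1\Big]\\&+\Big[\Big(\alpha_i^4\frac{R_i^4}{n^2}\frac{b_{Q_2}(2;X_i)}{t^2}+\frac{R_i^4}{n^2}\frac{b_L(4;X_i)}{t^2}+\alpha_i^2\frac{R_i^2}{n}\frac{b_L(2;X_i)}{t}\Big)\wedge1\\&\qquad+\frac{R_i^4}{n^2}\frac{b_L(4;X_i)}{t^2}+\alpha_i^2\frac{R_i^2}{n}\frac{b_L(2;X_i)}{t}\Big]\Big\}.\end{aligned}$$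 Furthermore, $$\left|\mathbb{E}[G(\alpha;X)-G(\alpha;Y)]\right|\le\sum_{i=1}^n\big(U_{i,1}(X_i)+U_{i,2}(X_i)+U_{i,1}(Y_i)+U_{i,2}(Y_i)\big),$$ where $$U_{i,1}(X_i)\le K\frac{b(A;\Sigma_\varepsilon)}{\sqrt t}\left(\frac{R_i^2}{\sqrt n}\sqrt{\frac{b_{Q_2}(2;X_i)}{nt}}\wedge1\right)\left[\frac{|\alpha_i|R_i}{\sqrt n}\sqrt{b_L(2;X_i)}+\frac{R_i^2}{n}\sqrt{b_L(4;X_i)}\frac1{\sqrt t}\right],$$ $$\begin{aligned}U_{i,2}(X_i)\le K\,b(A;\Sigma_\varepsilon)\Big[&\Big(\alpha_i^2+\frac{R_i^2}{n}\frac{b_L(2;X_i)}{t}\Big)\wedge\sqrt{\frac{b_{Q_2}(2;X_i)}{n}}\Big\{\frac{R_i^2}{\sqrt n}\Big(\frac{\alpha_i^2}{t}+\frac{R_i^2}{n}\frac1{t^2}\sqrt{b_L(4;X_i)}\Big)\\&\qquad+\frac1{t^{3/2}}\Big(\frac{R_i^4}{n^{3/2}}\frac1{t^{1/2}}\sqrt{b_L(4;X_i)}+\frac{|\alpha_i|R_i^3}{n}\sqrt{b_L(2;X_i)}\Big)\Big\}\Big],\end{aligned}$$ and $U_{i,1}(Y_i),U_{i,2}(Y_i)$ satisfy the same bounds with $Y_i$ in place of $X_i$. (In the bound for $U_{i,2}$ the minimum $\wedge$ is between the first parenthesis and the whole product $\sqrt{b_{Q_2}(2;X_i)/n}\,\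{\cdots\}$.)
   Context: Notation: $X$ (resp. $Y$) is the $n\times p$ matrix whose $i$-th row is $X_i^\top$ (resp. $Y_i^\top$). $a\wedge b=\min(a,b)$; $\succeq$ is the Loewner order; $\|\cdot\|_{op}$ is the operator norm; $\|\alpha\|$ is the Euclidean norm. $K$ is a numerical constant. Standing assumptions: the ratio $p/n$ stays bounded away from $0$ and $\infty$; the $X_j$ are independent, the $Y_j$ are independent, and the $Y_j$'s are independent of the $X_j$'s; for each $j$, $X_j$ and $Y_j$ have mean $0$ and the same covariance matrix $\Sigma_j$. For $Z\in\{X_j,Y_j\}$ and $k\ge1$, $b_L(k;Z)$ and $b_{Q_2}(k;Z)$ are deterministic numbers (finite for the exponents that appear) such that $\mathbb{E}|Z^\top v|^k\le b_L(k;Z)$ for every deterministic unit vector $v$, and $\mathbb{E}|Z^\top MZ-\mathbb{E}[Z^\top MZ]|^k\le b_{Q_2}(k;Z)$ for every deterministic positive semidefinite $M$ with $\|M\|_{op}\le1$. Without loss of generality $b_L(k;Z)\le\sqrt{b_L(2k;Z)}$. *)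

(* Defs.v *)
From HB Require Import structures.
From mathcomp Require Import all_boot all_order all_algebra.
From mathcomp Require Import all_classical all_reals all_analysis.

Set Implicit Arguments.
Unset Strict Implicit.
Unset Printing Implicit Defensive.

Import Order.TTheory GRing.Theory Num.Theory.
Import numFieldNormedType.Exports.

Local Open Scope classical_set_scope.
Local Open Scope ring_scope.

Section linear_algebra.
Variable R : realType.

Definition enorm p (v : 'cV[R]_p) : R := Num.sqrt (\sum_i v i 0 ^+ 2).

(* The norm on 'M[R]_(m, n) provided by the library is the entrywise maximum;
   this is the operator norm for Euclidean norms. *)
Definition opnorm m n (M : 'M[R]_(m, n)) : R :=
  sup [set enorm (M *m v) | v in [set v : 'cV[R]_n | enorm v <= 1]].

Definition psdmx p (M : 'M[R]_p) : Prop :=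
  M^T = M /\ forall v : 'cV[R]_p, 0 <= (v^T *m M *m v) 0 0.

Definition pdmx p (M : 'M[R]_p) : Prop :=
  M^T = M /\ forall v : 'cV[R]_p, v != 0 -> 0 < (v^T *m M *m v) 0 0.

Definition loewner_le p (M N : 'M[R]_p) : Prop := psdmx (N - M).

(* The unique positive semidefinite square root when [M] is positive
   semidefinite, and 0 otherwise. *)
Definition sqrtmx p (M : 'M[R]_p) : 'M[R]_p :=
  xget 0 [set S : 'M[R]_p | psdmx S /\ S *m S = M].

Definition bA p (A Se : 'M[R]_p) : R :=
  opnorm (invmx (sqrtmx A) *m Se *m invmx (sqrtmx A)).

Definition Gform n p (rho : 'I_n -> R) (A Se : 'M[R]_p) (alpha : 'cV[R]_n)
    (x : 'M[R]_(n, p)) : R :=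
  let D := diag_mx (\row_i rho i) in
  let s := (Num.sqrt n%:R)^-1 in
  let M := n%:R^-1 *: (x^T *m (D *m D) *m x) + A in
  (alpha^T *m (s *: (D *m x)) *m invmx M *m Se *m invmx M
     *m (s *: (x^T *m D)) *m alpha) 0 0.

End linear_algebra.

Section bounds.
Variable R : realType.

(* Here [a], [r], [lk], [qk] stand for alpha_i, R_i, b_L(k; Z), b_{Q_2}(k; Z),
   and [b] for b(A; Sigma_eps). *)
Definition Vbound (n : nat) (K b t a r l2 l4 q2 : R) : R :=
  K * b ^+ 2 *
  (a ^+ 4 * Num.min (r ^+ 4 / n%:R ^+ 2 * (q2 / t ^+ 2)) 1
   + (Num.min (a ^+ 4 * (r ^+ 4 / n%:R ^+ 2) * (q2 / t ^+ 2)
               + r ^+ 4 / n%:R ^+ 2 * (l4 / t ^+ 2)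
               + a ^+ 2 * (r ^+ 2 / n%:R) * (l2 / t)) 1
      + r ^+ 4 / n%:R ^+ 2 * (l4 / t ^+ 2)
      + a ^+ 2 * (r ^+ 2 / n%:R) * (l2 / t))).

Definition U1bound (n : nat) (K b t a r l2 l4 q2 : R) : R :=
  K * (b / Num.sqrt t)
  * Num.min (r ^+ 2 / Num.sqrt n%:R * Num.sqrt (q2 / (n%:R * t))) 1
  * (`|a| * r / Num.sqrt n%:R * Num.sqrt l2
     + r ^+ 2 / n%:R * Num.sqrt l4 * (Num.sqrt t)^-1).

(* t^{3/2} is written t * sqrt t, and n^{3/2} likewise. *)
Definition U2bound (n : nat) (K b t a r l2 l4 q2 : R) : R :=
  K * b *
  Num.min
    (a ^+ 2 + r ^+ 2 / n%:R * (l2 / t))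
    (Num.sqrt (q2 / n%:R) *
     (r ^+ 2 / Num.sqrt n%:R
        * (a ^+ 2 / t + r ^+ 2 / n%:R * (t ^+ 2)^-1 * Num.sqrt l4)
      + (t * Num.sqrt t)^-1
        * (r ^+ 4 / (n%:R * Num.sqrt n%:R) * (Num.sqrt t)^-1 * Num.sqrt l4
           + `|a| * r ^+ 3 / n%:R * Num.sqrt l2))).

End bounds.

Section probability.
Context d (T : measurableType d) (R : realType) (P : probability T R).

Definition mutually_independent (I : finType) d' (T' : measurableType d')
    (Z : I -> {RV P >-> T'}) : Prop :=
  forall (J : {set I}) (B : I -> set T'),
    (forall i, i \in J -> measurable (B i)) ->
    P (\bigcap_(i in [set` J]) (Z i @^-1` B i)) =
    (\prod_(i in J) P (Z i @^-1` B i))%E.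

(* The sigma-algebras generated by two whole families of random elements are
   independent: events are taken in the product sigma-algebra. *)
Definition independent_families n d' (T' : measurableType d')
    (Z Z' : 'I_n -> {RV P >-> T'}) : Prop :=
  forall B B' : set (n.-tuple T'), measurable B -> measurable B' ->
    P ([set w | B [tuple Z i w | i < n]] `&` [set w | B' [tuple Z' i w | i < n]])
    = (P [set w | B [tuple Z i w | i < n]]
       * P [set w | B' [tuple Z' i w | i < n]])%E.

(* Random vectors take values in p.-tuple R, which carries the product (that is,
   Borel) sigma-algebra. *)
Definition colvec p (x : p.-tuple R) : 'cV[R]_p := \col_j tnth x j.

Definition data_mx n p (Z : 'I_n -> {RV P >-> p.-tuple R}) (w : T)
    : 'M[R]_(n, p) :=
  \matrix_(i, j) tnth (Z i w) j.

Definition centered_cov p (Z : {RV P >-> p.-tuple R}) (S : 'M[R]_p) : Prop :=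
  (forall j, 'E_P[fun w => tnth (Z w) j] = 0)%E /\
  (forall j k,
     covariance P (fun w => tnth (Z w) j) (fun w => tnth (Z w) k)
     = (S j k)%:E)%E.

Definition linear_moments p (Z : {RV P >-> p.-tuple R}) (bL : nat -> \bar R)
    : Prop :=
  forall (k : nat) (v : 'cV[R]_p), (1 <= k)%N -> enorm v = 1 ->
    let l w := ((colvec (Z w))^T *m v) 0 0 in
    ('E_P[fun w => (`|l w| ^+ k)%R] <= bL k)%E.

Definition quadratic_moments p (Z : {RV P >-> p.-tuple R}) (bQ : nat -> \bar R)
    : Prop :=
  forall (k : nat) (M : 'M[R]_p), (1 <= k)%N -> psdmx M -> opnorm M <= 1 ->
    let q w := ((colvec (Z w))^T *m M *m colvec (Z w)) 0 0 in
    ('E_P[fun w => (`|q w - fine 'E_P[q]%E| ^+ k)%R] <= bQ k)%E.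

(* [bL] and [bQ] may be infinite except at the exponents used in the bounds. *)
Definition moment_bounds p (Z : {RV P >-> p.-tuple R}) (bL bQ : nat -> \bar R)
    : Prop :=
  [/\ linear_moments Z bL,
      quadratic_moments Z bQ,
      [/\ bL 2%N \is a fin_num, bL 4%N \is a fin_num & bQ 2%N \is a fin_num] &
      forall k, (1 <= k)%N -> (bL k <= sqrte (bL (2 * k)%N))%E].

End probability.

(* Main.v *)
Require Import Defs.
From HB Require Import structures.
From mathcomp Require Import all_boot all_order all_algebra.
From mathcomp Require Import all_classical all_reals all_analysis.
From mathcomp Require Import measurable_realfun.
From mathcomp Require Import ring lra complex.
Set Implicit Arguments.
Unset Strict Implicit.
Unset Printing Implicit Defensive.
Import Order.TTheory GRing.Theory Num.Theory.
Import numFieldNormedType.Exports.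
Local Open Scope classical_set_scope.
Local Open Scope ring_scope.

(** Write [w_i = (R_i / sqrt n) X_i] for the rescaled observations and let [N] be the matrix
    [A + sum_(j != i) w_j w_j^T] with observation [i] left out. [G] is the value of the
    quadratic form [Sigma_eps] at [y = M^-1 X^T D alpha / sqrt n]. By Sherman-Morrison [y]
    differs from its leave-one-out version [h] by a multiple of [N^-1 w_i], and
    [G = g + 2 r s + r^2 q] with [r = (alpha_i - m) / (1 + c)], where [g] does not depend on
    observation [i], [m] and [s] are linear in [X_i], and [c] and [q] are quadratic in [X_i]
    (lemma [Gform_set_row]). Since [Sigma_eps <= b(A; Sigma_eps) A <= b(A; Sigma_eps) N]
    (lemma [dot_le_bA]; the square root of [A] in the definition of [b(A; Sigma_eps)] is
    obtained from the spectrum of [A] by interpolation), one may divide by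
    [b(A; Sigma_eps)] and assume [Sigma_eps <= A]. The squared norms of the
    coefficient vectors of [m] and [s] and the operator norms of the coefficient matrices of
    [c] and [q] are then at most [tau_i = R_i^2 / (n t)], uniformly in the other
    observations, and [0 <= q <= c].

    Variance. By the Efron-Stein inequality (lemma [efron_stein]) it suffices to compare
    [G], along each observation and with the others fixed, with some constant. The constant
    is the value of the expansion at [m = s = 0] and at the means of [c] and [q]. The error
    is controlled by the moments of [m] and [s] and by the mean square distance of
    [q / (1 + c)^2] to its frozen value, which is bounded both by 1 and by a multiple of
    the variances of [c] and [q].

    Means. The observations [X_i] are replaced by [Y_i] one at a time (lemma [lindeberg]). If
    [c] and [q] are frozen at their means, the mean of the expansion depends only on the
    covariance of the observation, which [X_i] and [Y_i] share, and it cancels. The error of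
    freezing is at most [alpha_i^2 + tau_i b_L(2)] up to a constant, as [1 / (1 + c)] and
    [q / (1 + c)^2] lie between 0 and 1; by Cauchy-Schwarz it is also at most a combination
    of moments of [m] and [s], each multiplied by the standard deviation of [c] or of [q].
    These are the two sides of the minimum in the bound for [U_(i,2)], which thus absorbs
    the whole error: [U_(i,1)] is taken to be zero. *)

(** * Inner products, positive semidefinite forms and the operator norm *)

Section inner_product.
Context {R : realType}.

Definition dot p (u v : 'cV[R]_p) : R := (u^T *m v) 0 0.

Lemma dotE p (u v : 'cV[R]_p) : dot u v = \sum_i u i 0 * v i 0.
Proof. by rewrite /dot mxE; apply: eq_bigr => i _; rewrite mxE. Qed.

Lemma dotC p (u v : 'cV[R]_p) : dot u v = dot v u.
Proof. by rewrite !dotE; apply: eq_bigr => i _; rewrite mulrC. Qed.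

Lemma dotDl p (u v w : 'cV[R]_p) : dot (u + v) w = dot u w + dot v w.
Proof. by rewrite /dot linearD mulmxDl mxE. Qed.

Lemma dotDr p (u v w : 'cV[R]_p) : dot w (u + v) = dot w u + dot w v.
Proof. by rewrite /dot mulmxDr mxE. Qed.

Lemma dotZl p a (u v : 'cV[R]_p) : dot (a *: u) v = a * dot u v.
Proof. by rewrite /dot linearZ -scalemxAl mxE. Qed.

Lemma dotZr p a (u v : 'cV[R]_p) : dot u (a *: v) = a * dot u v.
Proof. by rewrite /dot -scalemxAr mxE. Qed.

Lemma dotNl p (u v : 'cV[R]_p) : dot (- u) v = - dot u v.
Proof. by rewrite -scaleN1r dotZl mulN1r. Qed.

Lemma dotNr p (u v : 'cV[R]_p) : dot u (- v) = - dot u v.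
Proof. by rewrite dotC dotNl dotC. Qed.

Lemma dot0l p (v : 'cV[R]_p) : dot 0 v = 0.
Proof. by rewrite /dot trmx0 mul0mx mxE. Qed.

Lemma dot_mulmxl m n (M : 'M[R]_(m, n)) u v :
  dot (M *m u) v = dot u (M^T *m v).
Proof. by rewrite /dot trmx_mul mulmxA. Qed.

Lemma dot_mulmxr m n (M : 'M[R]_(m, n)) u v :
  dot u (M *m v) = dot (M^T *m u) v.
Proof. by rewrite dot_mulmxl trmxK. Qed.

Lemma dot_ge0 p (u : 'cV[R]_p) : 0 <= dot u u.
Proof. by rewrite dotE sumr_ge0// => i _; rewrite -expr2 sqr_ge0. Qed.

Lemma dot_eq0 p (u : 'cV[R]_p) : (dot u u == 0) = (u == 0).
Proof.
apply/idP/eqP => [|->]; last by rewrite dot0l.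
rewrite dotE psumr_eq0 => [/allP h|i _]; last by rewrite -expr2 sqr_ge0.
apply/matrixP => i j; rewrite (ord1 j) mxE; apply/eqP.
by have := h i (mem_index_enum _); rewrite -expr2 sqrf_eq0.
Qed.

Lemma dot_gt0 p (u : 'cV[R]_p) : u != 0 -> 0 < dot u u.
Proof. by move=> u0; rewrite lt0r dot_ge0 dot_eq0 u0. Qed.

(** A rank-one matrix applied to a vector; with [u = v] this is the update of the
    Gram matrix by one observation. *)
Lemma dot_mx_dot p (u v w : 'cV[R]_p) : u *m v^T *m w = dot v w *: u.
Proof.
by rewrite -mulmxA [v^T *m w]mx11_scalar mul_mx_scalar.
Qed.

Lemma enorm_ge0 p (u : 'cV[R]_p) : 0 <= enorm u.
Proof. exact: sqrtr_ge0. Qed.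

Lemma enormE p (u : 'cV[R]_p) : enorm u = Num.sqrt (dot u u).
Proof. by rewrite /enorm dotE; under eq_bigr do rewrite expr2. Qed.

Lemma enorm2 p (u : 'cV[R]_p) : enorm u ^+ 2 = dot u u.
Proof. by rewrite enormE sqr_sqrtr// dot_ge0. Qed.

Lemma enormZ p a (u : 'cV[R]_p) : enorm (a *: u) = `|a| * enorm u.
Proof.
by rewrite !enormE dotZl dotZr mulrA -expr2 sqrtrM ?sqr_ge0// sqrtr_sqr.
Qed.

Lemma enorm0 p : enorm (0 : 'cV[R]_p) = 0.
Proof. by rewrite enormE dot0l sqrtr0. Qed.

Lemma enorm_eq0 p (u : 'cV[R]_p) : (enorm u == 0) = (u == 0).
Proof. by rewrite -dot_eq0 -enorm2 sqrf_eq0. Qed.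

(** A nonnegative quadratic polynomial has nonpositive discriminant. *)
Lemma discriminant_le0 (a b c : R) : 0 <= a ->
  (forall x y : R, 0 <= x ^+ 2 * a + 2 * x * y * b + y ^+ 2 * c) -> b ^+ 2 <= a * c.
Proof.
move=> a0 h; have := a0; rewrite le_eqVlt => /orP[/eqP a00|a_gt0].
  rewrite -a00 mul0r; have [->|b0] := eqVneq b 0; first by rewrite expr0n.
  (* With [a = 0] the form is affine in [x]; this [x] gives it the value [-1]. *)
  have := h (- (c + 1) / (2 * b)) 1; rewrite -a00.
  have -> : (- (c + 1) / (2 * b)) ^+ 2 * 0 + 2 * (- (c + 1) / (2 * b)) * 1 * b + 1 ^+ 2 * c = -1.
    by field.
  by lra.
have h0 : 0 <= a * (a * c - b ^+ 2).
  have := h (- b) a.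
  have -> : (- b) ^+ 2 * a + 2 * - b * a * b + a ^+ 2 * c = a * (a * c - b ^+ 2) by ring.
  by [].
by move: h0; rewrite pmulr_rge0// subr_ge0.
Qed.

Lemma psdmx_dot p (M : 'M[R]_p) v : psdmx M -> 0 <= dot v (M *m v).
Proof. by case=> _ /(_ v); rewrite /dot mulmxA. Qed.

(** The discriminant of the nonnegative form [M] on the plane spanned by [u] and [v]. *)
Lemma psdmx_cauchy_schwarz p (M : 'M[R]_p) u v : psdmx M ->
  dot u (M *m v) ^+ 2 <= dot u (M *m u) * dot v (M *m v).
Proof.
move=> M0; apply: discriminant_le0 => [|x y]; first exact: psdmx_dot.
have := psdmx_dot (x *: u + y *: v) M0.
rewrite mulmxDr !dotDl !dotDr -!scalemxAr !dotZl !dotZr.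
have -> : dot v (M *m u) = dot u (M *m v) by rewrite dotC dot_mulmxl; case: M0 => ->.
by move=> h; apply: le_trans h _; rewrite le_eqVlt; apply/orP; left; apply/eqP; ring.
Qed.

Lemma psdmx1 p : psdmx (1%:M : 'M[R]_p).
Proof. by split=> [|v]; rewrite ?trmx1// mulmx1; exact: dot_ge0. Qed.

Lemma cauchy_schwarz p (u v : 'cV[R]_p) : dot u v ^+ 2 <= dot u u * dot v v.
Proof. by have := psdmx_cauchy_schwarz u v (psdmx1 p); rewrite !mul1mx. Qed.

Lemma dot_le_enorm p (u v : 'cV[R]_p) : `|dot u v| <= enorm u * enorm v.
Proof.
by rewrite !enormE -sqrtrM ?dot_ge0// -sqrtr_sqr ler_sqrt ?mulr_ge0 ?dot_ge0// cauchy_schwarz.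
Qed.

(** The Frobenius norm is a bound. It makes the supremum defining [opnorm] the
    supremum of a bounded set, without which it would carry no information. *)
Lemma enorm_mulmx_bounded m n (M : 'M[R]_(m, n)) :
  exists2 c, 0 <= c & forall v : 'cV[R]_n, enorm (M *m v) <= c * enorm v.
Proof.
exists (Num.sqrt (\sum_i dot (row i M)^T (row i M)^T)) => [|v].
  exact: sqrtr_ge0.
rewrite !enormE -sqrtrM; last by apply: sumr_ge0 => i _; exact: dot_ge0.
rewrite ler_sqrt; last by rewrite mulr_ge0 ?dot_ge0//; apply: sumr_ge0 => i _; exact: dot_ge0.
rewrite [X in X <= _]dotE mulr_suml; apply: ler_sum => i _.
have -> : (M *m v) i 0 = dot (row i M)^T v.
  by rewrite dotE mxE; apply: eq_bigr => j _; rewrite !mxE.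
by rewrite -expr2 cauchy_schwarz.
Qed.

Lemma enorm_le_opnorm m n (M : 'M[R]_(m, n)) v :
  enorm v <= 1 -> enorm (M *m v) <= opnorm M.
Proof.
move=> v1; have [c c0 hc] := enorm_mulmx_bounded M.
suff hub : has_ubound [set enorm (M *m v) | v in [set v : 'cV[R]_n | enorm v <= 1]].
  by apply: (ub_le_sup hub); exists v.
exists c => _ [u /= u1 <-]; rewrite (le_trans (hc u))//.
by rewrite -[leRHS]mulr1 ler_wpM2l.
Qed.

Lemma opnorm_ge0 m n (M : 'M[R]_(m, n)) : 0 <= opnorm M.
Proof.
apply: le_trans (enorm_ge0 (M *m 0)) (enorm_le_opnorm _ _).
by rewrite enorm0.
Qed.

Lemma enorm_mulmx m n (M : 'M[R]_(m, n)) v : enorm (M *m v) <= opnorm M * enorm v.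
Proof.
have [->|v0] := eqVneq v 0; first by rewrite mulmx0 !enorm0 mulr0.
have ev : 0 < enorm v by rewrite lt0r enorm_ge0 enorm_eq0 v0.
rewrite -ler_pdivrMr// mulrC -[X in X * _]ger0_norm ?invr_ge0 ?(ltW ev)//.
rewrite -enormZ scalemxAr enorm_le_opnorm//.
by rewrite enormZ ger0_norm ?invr_ge0 ?(ltW ev)// mulVf// gt_eqF.
Qed.

(** For a positive semidefinite matrix the operator norm is the top of the
    Rayleigh quotient: apply the Cauchy-Schwarz inequality of the form [M] to
    [v] and [M *m v]. *)
Lemma psdmx_opnorm_le p (M : 'M[R]_p) (b : R) : psdmx M -> 0 <= b ->
  (forall v, dot v (M *m v) <= b * dot v v) -> opnorm M <= b.
Proof.
move=> M0 b0 hM; rewrite /opnorm; apply: ge_sup.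
  by exists (enorm (M *m 0)), 0 => //=; rewrite enorm0.
move=> _ [v /= v1 <-].
have h : dot (M *m v) (M *m v) <= b * enorm v * enorm (M *m v).
  have [/eqP z|z] := boolP (dot (M *m v) (M *m v) == 0).
    by rewrite z !mulr_ge0 ?enorm_ge0.
  rewrite -(@ler_pXn2r _ 2) ?nnegrE ?dot_ge0 ?mulr_ge0 ?enorm_ge0//.
  rewrite (le_trans (psdmx_cauchy_schwarz _ _ M0))//.
  have -> : (b * enorm v * enorm (M *m v)) ^+ 2
      = (b * dot (M *m v) (M *m v)) * (b * dot v v) by rewrite -!enorm2; ring.
  by apply: ler_pM; rewrite ?psdmx_dot.
have [/eqP ->//|z] := boolP (enorm (M *m v) == 0).
have z0 : 0 < enorm (M *m v) by rewrite lt0r z enorm_ge0.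
have : enorm (M *m v) <= b * enorm v.
  by rewrite -(ler_pM2r z0) -expr2 enorm2.
by move/le_trans; apply; rewrite -[leRHS]mulr1 ler_wpM2l.
Qed.

End inner_product.

(** * Square roots of positive definite matrices *)

Section square_root.
Context {R : realType}.

Lemma Re_sum I (r : seq I) (F : I -> R[i]) :
  complex.Re (\sum_(i <- r) F i) = \sum_(i <- r) complex.Re (F i).
Proof. by elim/big_rec2: _ => // i x y _ <-; case: (F i) y => a b [c d]. Qed.

Lemma Im_sum I (r : seq I) (F : I -> R[i]) :
  complex.Im (\sum_(i <- r) F i) = \sum_(i <- r) complex.Im (F i).
Proof. by elim/big_rec2: _ => // i x y _ <-; case: (F i) y => a b [c d]. Qed.

(** If [x + i y] is an eigenvector of the real symmetric matrix [A] for [a + i b],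
    comparing [dot (A x) y] with [dot x (A y)] gives [b (|x|^2 + |y|^2) = 0]; then [x] or
    [y] is a real eigenvector, and its Rayleigh quotient is positive. *)
Lemma pdmx_complex_eigenvalue p (A : 'M[R]_p) (z : R[i]) : pdmx A ->
  eigenvalue (map_mx (real_complex R) A) z ->
  exists2 a : R, z = real_complex R a & 0 < a.
Proof.
case=> As Apos /eigenvalueP[v vA v0].
pose x : 'cV[R]_p := \col_j complex.Re (v 0 j).
pose y : 'cV[R]_p := \col_j complex.Im (v 0 j).
case: z => a b in vA *.
have eA j : \sum_i v 0 i * real_complex R (A i j) = (a +i* b)%C * v 0 j.
  move/rowP/(_ j): vA; rewrite !mxE => <-.
  by apply: eq_bigr => i _; rewrite mxE.
have Ax : A *m x = a *: x - b *: y.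
  apply/colP => j; rewrite !mxE.
  transitivity (complex.Re (\sum_i v 0 i * real_complex R (A i j))).
    rewrite Re_sum; apply: eq_bigr => i _; rewrite !mxE -{1}As mxE.
    by case: (v 0 i) => c d /=; rewrite mulr0 subr0 mulrC.
  by rewrite eA; case: (v 0 j).
have Ay : A *m y = b *: x + a *: y.
  apply/colP => j; rewrite !mxE.
  transitivity (complex.Im (\sum_i v 0 i * real_complex R (A i j))).
    rewrite Im_sum; apply: eq_bigr => i _; rewrite !mxE -{1}As mxE.
    by case: (v 0 i) => c d /=; rewrite mulr0 add0r mulrC.
  by rewrite eA; case: (v 0 j) => c d /=; rewrite addrC.
have xy0 : (x != 0) || (y != 0).
  rewrite -negb_and; apply: contra v0 => /andP[/eqP x0 /eqP y0].
  apply/eqP/rowP => j; move/colP/(_ j): x0; move/colP/(_ j): y0; rewrite !mxE.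
  by case: (v 0 j) => c d /= -> ->.
have b0 : b = 0.
  have : dot (A *m x) y = dot x (A *m y) by rewrite dot_mulmxl As.
  rewrite Ax Ay dotDl dotNl dotDr !dotZl !dotZr => h.
  have : b * (dot x x + dot y y) = 0 by lra.
  move/eqP; rewrite mulf_eq0 => /orP[/eqP//|].
  rewrite paddr_eq0 ?dot_ge0// !dot_eq0 => /andP[/negPn x0 /negPn y0].
  by move: xy0; rewrite (negbTE x0) (negbTE y0).
exists a; first by rewrite b0.
move: Ax Ay; rewrite b0 !scale0r subr0 add0r => Ax Ay.
case/orP: xy0 => w0.
  by have := Apos _ w0; rewrite -mulmxA -/(dot _ _) Ax dotZr pmulr_lgt0// dot_gt0.
by have := Apos _ w0; rewrite -mulmxA -/(dot _ _) Ay dotZr pmulr_lgt0// dot_gt0.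
Qed.

Lemma pdmx_char_poly p (A : 'M[R]_p) : pdmx A ->
  exists2 s : seq R, all (fun a => 0 < a) s & char_poly A = \prod_(z <- s) ('X - z%:P).
Proof.
move=> Apd; set f := real_complex R.
have [r] := closed_field_poly_normal (map_poly f (char_poly A)).
rewrite (monicP _) ?scale1r; last by rewrite monic_map// char_poly_monic.
move=> er.
have hr z : z \in r -> exists2 a : R, z = f a & 0 < a.
  move=> zr; apply: pdmx_complex_eigenvalue Apd _.
  by rewrite eigenvalue_root_char -map_char_poly er root_prod_XsubC.
have {hr} [s s0 rs] : exists2 s : seq R, all (fun a => 0 < a) s & r = map f s.
  elim: r {er} hr => [|z r IH] hr; first by exists nil.
  have [s s0 ->] := IH (fun w wr => hr w (@mem_behead _ (z :: r) w wr)).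
  have [a -> a0] := hr z (mem_head _ _).
  by exists (a :: s) => //=; rewrite a0.
exists s => //; apply: (map_poly_inj f); rewrite er rs big_map rmorph_prod.
by apply: eq_bigr => z _; rewrite rmorphB/= map_polyX map_polyC.
Qed.

Lemma horner_mx_sym p (A : 'M[R]_p.+1) q : A^T = A -> (horner_mx A q)^T = horner_mx A q.
Proof.
move=> As; elim/poly_ind: q => [|q c IH]; first by rewrite rmorph0 trmx0.
rewrite rmorphD rmorphM/= horner_mx_X horner_mx_C linearD/= tr_scalar_mx.
by rewrite -mulmxE trmx_mul IH As (comm_mx_horner q (erefl (A *m A))).
Qed.

(** A symmetric matrix is semisimple: [(A - z)^2 v = 0] forces [|(A - z) v|^2 = 0],
    so that repeated factors of an annihilating polynomial may be dropped. *)
Lemma horner_mx_sqr_XsubC p (A : 'M[R]_p.+1) (z : R) q : A^T = A ->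
  horner_mx A (q * ('X - z%:P) * ('X - z%:P)) = 0 -> horner_mx A (q * ('X - z%:P)) = 0.
Proof.
move=> As h; set B := horner_mx A (q * _).
have Bs : B^T = B by exact: horner_mx_sym.
suff BB : B *m B = 0.
  apply/matrixP => i j; rewrite [RHS]mxE.
  have : dot (B *m delta_mx j 0) (B *m delta_mx j 0) == 0.
    by rewrite dot_mulmxl Bs mulmxA BB mul0mx dotC dot0l.
  by rewrite dot_eq0 -colE => /eqP/matrixP/(_ i 0); rewrite !mxE.
rewrite mulmxE -rmorphM/=.
have -> : q * ('X - z%:P) * (q * ('X - z%:P)) = q * (q * ('X - z%:P) * ('X - z%:P)) by ring.
by rewrite rmorphM/= h mulr0.
Qed.

(** Together with Cayley-Hamilton: a symmetric matrix is annihilated by the product of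
    the linear factors of its distinct eigenvalues. *)
Lemma horner_mx_undup p (A : 'M[R]_p.+1) (s : seq R) q : A^T = A ->
  horner_mx A (q * \prod_(z <- s) ('X - z%:P)) = 0 ->
  horner_mx A (q * \prod_(z <- undup s) ('X - z%:P)) = 0.
Proof.
move=> As; elim: s q => [//|z s IH] q; rewrite big_cons mulrA => /IH /=.
case: ifPn => zs; last by rewrite big_cons mulrA.
rewrite (big_rem z) ?mem_undup//= => h.
have := @horner_mx_sqr_XsubC _ A z (q * \prod_(y <- rem z (undup s)) ('X - y%:P)) As.
have -> : q * \prod_(y <- rem z (undup s)) ('X - y%:P) * ('X - z%:P)
  = q * (('X - z%:P) * \prod_(y <- rem z (undup s)) ('X - y%:P)) by ring.
by apply; rewrite -h; congr horner_mx; ring.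
Qed.

(** Newton interpolation: add a multiple of the polynomial vanishing at the previous
    nodes. *)
Lemma interpolation (s : seq R) (g : R -> R) : uniq s ->
  exists q : {poly R}, {in s, forall z, q.[z] = g z}.
Proof.
elim: s => [|z s IH] /=; first by exists 0.
case/andP=> zs /IH[q hq].
pose P := \prod_(y <- s) ('X - y%:P).
have Pz : P.[z] != 0 by rewrite -rootE root_prod_XsubC.
exists (q + ((g z - q.[z]) / P.[z]) *: P) => y; rewrite inE => /orP[/eqP->|ys].
  by rewrite hornerD hornerZ divfK// addrC subrK.
rewrite hornerD hornerZ hq//.
by have /rootP -> : root P y; rewrite ?root_prod_XsubC// mulr0 addr0.
Qed.

(** With [q] interpolating the fourth root on the spectrum, [q ^+ 4 - 'X] vanishes at every
    eigenvalue, so [q(A)^2] is a square root of [A]; it is positive semidefinite because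
    it is the square of the symmetric matrix [q(A)]. *)
Lemma pdmx_sqrt_exists p (A : 'M[R]_p.+1) : pdmx A ->
  exists S : 'M[R]_p.+1, psdmx S /\ S *m S = A.
Proof.
move=> Apd; have As := Apd.1.
have [s s0 cA] := pdmx_char_poly Apd.
have P0 : horner_mx A (\prod_(z <- undup s) ('X - z%:P)) = 0.
  rewrite -[\prod_(z <- _) _]mul1r; apply: horner_mx_undup => //.
  by rewrite mul1r -cA Cayley_Hamilton.
have [q hq] := interpolation (fun z => Num.sqrt (Num.sqrt z)) (undup_uniq s).
have qs := horner_mx_sym q As.
exists (horner_mx A q *m horner_mx A q); split.
  split=> [|v]; first by rewrite trmx_mul qs.
  by rewrite -mulmxA -/(dot _ _) -mulmxA dot_mulmxr qs dot_ge0.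
have /dvdpP[d hd] : \prod_(z <- undup s) ('X - z%:P) %| q ^+ 4 - 'X.
  apply: uniq_roots_dvdp; last by rewrite uniq_rootsE undup_uniq.
  apply/allP => z zs; rewrite rootE hornerD hornerN hornerX horner_exp hq//.
  have z0 : 0 <= z by apply/ltW/(allP s0); rewrite -mem_undup.
  by rewrite (exprM _ 2 2) sqr_sqrtr ?sqrtr_ge0// sqr_sqrtr// subrr.
have : horner_mx A (q ^+ 4 - 'X) = 0 by rewrite hd rmorphM/= P0 mulr0.
rewrite rmorphB/= horner_mx_X => /eqP; rewrite subr_eq0 => /eqP hA; rewrite -[RHS]hA.
by rewrite rmorphXn/= !mulmxE !exprS expr0 mulr1 !mulrA.
Qed.

Lemma sqrtmxP p (A : 'M[R]_p.+1) : pdmx A ->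
  psdmx (sqrtmx A) /\ sqrtmx A *m sqrtmx A = A.
Proof.
move=> /pdmx_sqrt_exists [S hS].
exact: (@xgetPex _ 0 [set S : 'M[R]_p.+1 | psdmx S /\ S *m S = A] (ex_intro _ S hS)).
Qed.

Lemma pdmx_unitmx p (A : 'M[R]_p) : pdmx A -> A \in unitmx.
Proof.
move=> [As Apos]; rewrite -row_free_unit -kermx_eq0; apply/eqP/row_matrixP => i.
rewrite row0; apply/eqP; apply: contraT => k0.
have /Apos : (row i (kermx A))^T != 0 by rewrite trmx_eq0.
by rewrite trmxK -row_mul mulmx_ker row0 mul0mx mxE ltxx.
Qed.

Lemma bA_ge0 p (A Se : 'M[R]_p) : 0 <= bA A Se.
Proof. exact: opnorm_ge0. Qed.

(** [bA A Se] is the least [b] with [Se <= b A] in the Loewner order; substituting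
    [v = A^(-1/2) u] reduces the inequality to the one defining the operator norm. *)
Lemma dot_le_bA p (A Se : 'M[R]_p.+1) v : pdmx A -> 
  dot v (Se *m v) <= bA A Se * dot v (A *m v).
Proof.
move=> Apd; have [[Ss _] SS] := sqrtmxP Apd; set S := sqrtmx A in Ss SS *.
have Su : S \in unitmx.
  by move: (pdmx_unitmx Apd); rewrite -SS unitmx_mul => /andP[].
pose u := S *m v; have vu : v = invmx S *m u by rewrite mulKmx.
have -> : dot v (A *m v) = enorm u ^+ 2 by rewrite enorm2 -SS -mulmxA dot_mulmxr Ss.
clearbody u; rewrite {1 2}vu dot_mulmxl trmx_inv Ss !mulmxA.
rewrite (le_trans (ler_norm _))// (le_trans (dot_le_enorm _ _))// mulrC expr2 mulrA.
by rewrite ler_wpM2r ?enorm_ge0// enorm_mulmx.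
Qed.

End square_root.

(** * The leave-one-out expansion of the risk *)

Section ridge.
Context {R : realType} (n p : nat).
Variables (A S : 'M[R]_p) (t : R) (alpha : 'cV[R]_n).
Hypotheses (Apd : pdmx A) (t0 : 0 < t) (tA : loewner_le t%:M A).
Hypotheses (S0 : psdmx S) (SA : forall v, dot v (S *m v) <= dot v (A *m v)).
Hypothesis alpha1 : dot alpha alpha <= 1.

Definition ridge (W : 'M[R]_(n, p)) : 'M[R]_p := W^T *m W + A.

(** The ridge regression estimate: the vector at which [Gform] evaluates the
    quadratic form [S]. *)
Definition ridge_estimate (W : 'M[R]_(n, p)) : 'cV[R]_p :=
  invmx (ridge W) *m (W^T *m alpha).

Section facts.
Variable W : 'M[R]_(n, p).
Let N := ridge W.
Let C := invmx N.
Let h := ridge_estimate W.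

Lemma ridge_dot v : dot v (N *m v) = dot (W *m v) (W *m v) + dot v (A *m v).
Proof. by rewrite mulmxDl dotDr -mulmxA [in LHS]dot_mulmxr trmxK. Qed.

Lemma ridge_sym : N^T = N.
Proof. by rewrite /N /ridge linearD/= trmx_mul trmxK Apd.1. Qed.

Lemma ridge_pd : pdmx N.
Proof.
split=> [|v v0]; first exact: ridge_sym.
rewrite -mulmxA -/(dot _ _) ridge_dot ltr_wpDl ?dot_ge0//.
by rewrite /dot mulmxA; exact: Apd.2.
Qed.

Lemma ridge_unit : N \in unitmx. Proof. exact/pdmx_unitmx/ridge_pd. Qed.

Lemma ridge_inv_sym : C^T = C.
Proof. by rewrite /C trmx_inv ridge_sym. Qed.

Lemma A_le_ridge v : dot v (A *m v) <= dot v (N *m v).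
Proof. by rewrite ridge_dot lerDr dot_ge0. Qed.

Lemma t_le_A v : t * dot v v <= dot v (A *m v).
Proof.
have := psdmx_dot v tA; rewrite mulmxBl dotDr dotNr subr_ge0.
by rewrite mul_scalar_mx dotZr.
Qed.

Lemma t_le_ridge v : t * dot v v <= dot v (N *m v).
Proof. exact: le_trans (t_le_A v) (A_le_ridge v). Qed.

Lemma S_le_ridge v : dot v (S *m v) <= dot v (N *m v).
Proof. exact: le_trans (SA v) (A_le_ridge v). Qed.

(** The estimate minimises [|W h - alpha|^2 + h^T A h]; positivity of the residual
    gives the bound. *)
Lemma ridge_estimate_dot : dot h (N *m h) <= 1.
Proof.
have Nh : N *m h = W^T *m alpha by rewrite mulKVmx// ridge_unit.
have hN : dot h (N *m h) = dot (W *m h) alpha by rewrite Nh dot_mulmxl.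
have := dot_ge0 (W *m h - alpha).
rewrite !(dotDl, dotDr, dotNl, dotNr) (dotC alpha (W *m h)) -hN => h0.
have hA : dot (W *m h) (W *m h) <= dot h (N *m h).
  by rewrite ridge_dot lerDl (le_trans _ (t_le_A h))// mulr_ge0 ?dot_ge0// ltW.
by have := alpha1; lra.
Qed.

Lemma ridge_estimate_norm : t * dot h h <= 1.
Proof. exact: le_trans (t_le_ridge h) ridge_estimate_dot. Qed.

Let k := C *m (S *m h).

(** With [k = N^-1 S h], Cauchy-Schwarz for [S] gives
    [(k^T N k)^2 = (k^T S h)^2 <= (k^T S k) (h^T S h) <= k^T N k], as [S <= N]
    and [h^T N h <= 1]. *)
Lemma ridge_S_estimate_norm : t * dot k k <= 1.
Proof.
apply: le_trans (t_le_ridge k) _.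
have Nk : N *m k = S *m h by rewrite mulKVmx// ridge_unit.
set x := dot k (N *m k).
have x0 : 0 <= x by rewrite /x (le_trans _ (t_le_ridge k))// mulr_ge0 ?dot_ge0// ltW.
have : x ^+ 2 <= x * 1.
  rewrite {1}/x Nk (le_trans (psdmx_cauchy_schwarz _ _ S0))//.
  apply: ler_pM; rewrite ?psdmx_dot// ?S_le_ridge//.
  exact: le_trans (S_le_ridge h) ridge_estimate_dot.
have [->|xn0] := eqVneq x 0; first by rewrite ler01.
by rewrite expr2 ler_pM2l// lt0r xn0.
Qed.

Lemma ridge_inv_dot v : dot v (C *m v) = dot (C *m v) (N *m (C *m v)).
Proof. by rewrite mulKVmx ?ridge_unit// dotC. Qed.

Lemma ridge_inv_psd : psdmx C.
Proof.
split=> [|v]; first exact: ridge_inv_sym.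
rewrite -mulmxA -/(dot _ _) ridge_inv_dot (le_trans _ (t_le_ridge _))//.
by rewrite mulr_ge0 ?dot_ge0// ltW.
Qed.

(** From [0 <= |v - t y|^2] with [y = N^-1 v] and [t |y|^2 <= y^T N y = v^T y]. *)
Lemma ridge_inv_le v : dot v (C *m v) <= t^-1 * dot v v.
Proof.
set y := C *m v; have hy : t * dot y y <= dot v y by rewrite [leRHS]ridge_inv_dot t_le_ridge.
have := dot_ge0 (v - t *: y).
rewrite !(dotDl, dotDr, dotNl, dotNr, dotZl, dotZr) (dotC y v) => h0.
have : t * dot v y <= dot v v.
  have := ler_wpM2l (ltW t0) hy; lra.
by rewrite [t^-1 * _]mulrC ler_pdivlMr// [dot v y * t]mulrC.
Qed.

Let Q := C *m S *m C.

Lemma ridge_sandwich_dot v : dot v (Q *m v) = dot (C *m v) (S *m (C *m v)).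
Proof. by rewrite /Q -!mulmxA [in LHS]dot_mulmxr ridge_inv_sym. Qed.

Lemma ridge_sandwich_psd : psdmx Q.
Proof.
split=> [|v]; first by rewrite /Q !trmx_mul ridge_inv_sym S0.1 mulmxA.
by rewrite -mulmxA -/(dot _ _) ridge_sandwich_dot psdmx_dot.
Qed.

Lemma ridge_sandwich_le v : dot v (Q *m v) <= dot v (C *m v).
Proof. by rewrite ridge_sandwich_dot ridge_inv_dot S_le_ridge. Qed.

End facts.

(** Sherman-Morrison. Observation [i] being absent from [W], the ridge matrix of [W'] is
    [N + w w^T] and its right-hand side is [W^T alpha + a w]; the displayed vector solves
    the perturbed system. *)
Lemma ridge_estimate_rank1 (W W' : 'M[R]_(n, p)) (w : 'cV[R]_p) i :
  row i W = 0 -> W' = W + delta_mx i 0 *m w^T ->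
  let C := invmx (ridge W) in
  let h := ridge_estimate W in
  ridge_estimate W'
  = h + ((alpha i 0 - dot w h) / (1 + dot w (C *m w))) *: (C *m w).
Proof.
move=> Wi W'E C h.
have c0 : 1 + dot w (C *m w) != 0.
  by rewrite gt_eqF// ltr_wpDr// psdmx_dot//; exact: ridge_inv_psd.
have We : W^T *m delta_mx i 0 = 0 :> 'cV_p by rewrite -trmx_delta -trmx_mul -rowE Wi trmx0.
have N' : ridge W' = ridge W + w *m w^T.
  rewrite /ridge W'E [(_ + _)^T]linearD/= trmx_mul trmxK trmx_delta mulmxDl !mulmxDr.
  rewrite !mulmxA We mul0mx addr0 -[w *m delta_mx 0 i *m W]mulmxA -rowE Wi mulmx0 add0r.
  rewrite -[w *m _ *m _]mulmxA mul_delta_mx_cond eqxx mulr1n.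
  by rewrite addrAC; congr (_ + _ + _); rewrite [delta_mx 0 0]mx11_scalar mxE eqxx mulmx1.
have u' : W'^T *m alpha = W^T *m alpha + alpha i 0 *: w.
  rewrite W'E [(_ + _)^T]linearD/= trmx_mul trmxK trmx_delta mulmxDl; congr (_ + _).
  by rewrite -mulmxA -rowE [row i alpha]mx11_scalar mul_mx_scalar mxE.
rewrite {1}/ridge_estimate u' -[RHS](mulKmx (ridge_unit W')); congr (_ *m _).
have Nh : ridge W *m h = W^T *m alpha by rewrite mulKVmx// ridge_unit.
have Ng : ridge W *m (C *m w) = w by rewrite mulKVmx// ridge_unit.
rewrite N' mulmxDr ![(_ + w *m w^T) *m _]mulmxDl -!scalemxAr !dot_mx_dot Nh Ng.
rewrite -addrA; congr (_ + _).
rewrite scalerA -!scalerDl; congr (_ *: _).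
by field.
Qed.

Definition ridge_risk (W : 'M[R]_(n, p)) :=
  dot (ridge_estimate W) (S *m ridge_estimate W).

Lemma ridge_risk_rank1 (W W' : 'M[R]_(n, p)) (w : 'cV[R]_p) i :
  row i W = 0 -> W' = W + delta_mx i 0 *m w^T ->
  let C := invmx (ridge W) in
  let h := ridge_estimate W in
  let r := (alpha i 0 - dot w h) / (1 + dot w (C *m w)) in
  ridge_risk W' = ridge_risk W + 2 * r * dot w (C *m (S *m h))
                  + r ^+ 2 * dot w (C *m S *m C *m w).
Proof.
move=> Wi W'E C h r; rewrite {1}/ridge_risk (ridge_estimate_rank1 Wi W'E).
rewrite -/C -/h -/r mulmxDr !dotDl !dotDr -!scalemxAr !dotZl !dotZr.
have -> : dot h (S *m (C *m w)) = dot w (C *m (S *m h)).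
  by rewrite dotC !dot_mulmxl ridge_inv_sym S0.1.
have -> : dot (C *m w) (S *m h) = dot w (C *m (S *m h)).
  by rewrite dot_mulmxl ridge_inv_sym.
rewrite ridge_sandwich_dot /ridge_risk -/C -/h; ring.
Qed.

End ridge.

Section Gform.
Context {R : realType} (n p : nat).
Variables (rho : 'I_n -> R) (A : 'M[R]_p) (alpha : 'cV[R]_n).

Definition scaled_data (x : 'M[R]_(n, p)) : 'M[R]_(n, p) :=
  (Num.sqrt n%:R)^-1 *: (diag_mx (\row_i rho i) *m x).

Lemma GformE S x : pdmx A -> Gform rho A S alpha x = ridge_risk A S alpha (scaled_data x).
Proof.
move=> Apd; rewrite /Gform /ridge_risk /ridge_estimate.
set D := diag_mx _; set W := scaled_data x.
have WT : W^T = (Num.sqrt n%:R)^-1 *: (x^T *m D).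
  by rewrite /W linearZ/= trmx_mul tr_diag_mx.
have -> : n%:R^-1 *: (x^T *m (D *m D) *m x) + A = ridge A W.
  rewrite /ridge WT /W /scaled_data -scalemxAl -scalemxAr scalerA -invfM -expr2 sqr_sqrtr ?ler0n//.
  by rewrite !mulmxA.
rewrite -WT -/(scaled_data x) -/W.
by rewrite /dot trmx_mul (ridge_inv_sym Apd) trmx_mul trmxK !mulmxA.
Qed.

Lemma GformZ S b x : Gform rho A (b *: S) alpha x = b * Gform rho A S alpha x.
Proof. by rewrite /Gform -[_ *m (b *: S)]scalemxAr -!scalemxAl mxE. Qed.

Definition set_row (x : 'M[R]_(n, p)) i (y : 'cV[R]_p) : 'M[R]_(n, p) :=
  \matrix_(k, j) if k == i then y j 0 else x k j.

Variables (S : 'M[R]_p) (t : R).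
Hypotheses (Apd : pdmx A) (t0 : 0 < t) (tA : loewner_le t%:M A).
Hypotheses (S0 : psdmx S) (SA : forall v, dot v (S *m v) <= dot v (A *m v)).
Hypothesis alpha1 : dot alpha alpha <= 1.

Lemma Gform_ge0 x : 0 <= Gform rho A S alpha x.
Proof. by rewrite GformE//; exact: psdmx_dot. Qed.

Lemma Gform_le1 x : Gform rho A S alpha x <= 1.
Proof.
rewrite GformE//; apply: le_trans (S_le_ridge SA _ _) _.
exact: ridge_estimate_dot Apd t0 tA alpha1 _.
Qed.

(** What an observation with weight [a] adds to the risk, as a function of its two linear
    statistics [m], [s] and its two quadratic statistics [c], [q]. *)
Definition loo_increment (a m s c q : R) : R :=
  2 * ((a - m) / (1 + c)) * s + ((a - m) / (1 + c)) ^+ 2 * q.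

(** The leave-one-out expansion: when row [i] varies, the risk is a constant plus
    [loo_increment] of linear and quadratic forms of that row, whose coefficients are
    bounded by [tau] whatever the other rows are. *)
Lemma Gform_set_row (x : 'M[R]_(n, p)) i : 
  let tau := rho i ^+ 2 / (n%:R * t) in
  exists (g : R) (h k : 'cV[R]_p) (C Q : 'M[R]_p),
  [/\ dot h h <= tau /\ dot k k <= tau, psdmx C, psdmx Q /\
      (forall v, dot v (C *m v) <= tau * dot v v),
      forall v, dot v (Q *m v) <= dot v (C *m v) &
      forall y, Gform rho A S alpha (set_row x i y) =
        g + loo_increment (alpha i 0) (dot y h) (dot y k)
               (dot y (C *m y)) (dot y (Q *m y))].
Proof.
move=> tau.
have n0 : 0 < n%:R :> R by rewrite ltr0n (leq_ltn_trans _ (ltn_ord i)).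
pose sg := rho i / Num.sqrt n%:R.
have sg2 : sg ^+ 2 = rho i ^+ 2 / n%:R by rewrite expr_div_n sqr_sqrtr// ltW.
have tauE : tau = sg ^+ 2 * t^-1 by rewrite sg2 /tau invfM mulrA.
(* Removing observation [i] is the same as setting its row to zero. *)
pose W := scaled_data (set_row x i 0).
pose C := invmx (ridge A W); pose h := ridge_estimate A alpha W.
have Wi : row i W = 0.
  by apply/rowP => j; rewrite /W /scaled_data mul_diag_mx !mxE eqxx !mulr0.
have nrm v : t * dot v v <= 1 -> dot (sg *: v) (sg *: v) <= tau.
  move=> hv; rewrite dotZl dotZr mulrA -expr2 tauE ler_wpM2l ?sqr_ge0//.
  by rewrite -[leRHS]mul1r ler_pdivlMr// mulrC.
exists (ridge_risk A S alpha W), (sg *: h), (sg *: (C *m (S *m h))), (sg ^+ 2 *: C),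
   (sg ^+ 2 *: (C *m S *m C)).
have Cpsd : psdmx C := ridge_inv_psd Apd t0 tA W.
have Qpsd : psdmx (C *m S *m C) := ridge_sandwich_psd Apd S0 W.
have psdZ (B : 'M[R]_p) : psdmx B -> psdmx (sg ^+ 2 *: B).
  move=> [Bs B0]; split=> [|v]; first by rewrite linearZ/= Bs.
  by rewrite -scalemxAr -scalemxAl mxE mulr_ge0 ?sqr_ge0.
split; [split; apply: nrm| exact: psdZ|split; first exact: psdZ| | ].
- exact: ridge_estimate_norm Apd t0 tA alpha1 W.
- exact: ridge_S_estimate_norm Apd t0 tA S0 SA alpha1 W.
- move=> v; rewrite -scalemxAl dotZr tauE -mulrA ler_wpM2l ?sqr_ge0//.
  exact: ridge_inv_le.
- by move=> v; rewrite -!scalemxAl !dotZr ler_wpM2l ?sqr_ge0// ridge_sandwich_le.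
move=> y; have W'E : scaled_data (set_row x i y) = W + delta_mx i 0 *m (sg *: y)^T.
  apply/matrixP => k j; rewrite /W /scaled_data !mul_diag_mx !mxE big_ord1 !mxE eqxx andbT.
  case: eqVneq => [->|_]; last by rewrite mulr0n mul0r addr0.
  by rewrite !mulr0 add0r mulr1n mul1r /sg mulrA [_^-1 * _]mulrC.
rewrite GformE// (ridge_risk_rank1 alpha Apd t0 tA S0 Wi W'E) -/C -/h.
rewrite -!scalemxAl -!scalemxAr !dotZl !dotZr /loo_increment; rewrite -addrA.
by rewrite !expr2 -!mulrA.
Qed.

End Gform.

(** * Bounded functions of independent families and resampling *)

Section bounded_functions.
Context d (T : measurableType d) (R : realType) (P : probability T R).

Definition L1 (f : T -> R) := P.-integrable [set: T] (EFin \o f).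

Definition bounded_meas d' (T' : measurableType d') (f : T' -> R) :=
  measurable_fun [set: T'] f /\ exists B, forall x, `|f x| <= B.

Lemma bounded_meas_L1 f : bounded_meas f -> L1 f.
Proof.
case=> mf [B fB]; apply: (@le_integrable _ _ _ P _ _ _ (EFin \o cst B)) => //.
- exact/measurable_EFinP.
- by move=> x _ /=; rewrite lee_fin (le_trans (fB x))// ler_norm.
- exact: finite_measure_integrable_cst.
Qed.

Lemma L1_cst c : L1 (fun=> c).
Proof. exact: finite_measure_integrable_cst. Qed.

Lemma L1D f g : L1 f -> L1 g -> L1 (fun x => f x + g x).
Proof. by move=> hf hg; have := integrableD measurableT hf hg. Qed.

Lemma L1B f g : L1 f -> L1 g -> L1 (fun x => f x - g x).
Proof. by move=> hf hg; have := integrableB measurableT hf hg. Qed.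

Lemma L1Z c f : L1 f -> L1 (fun x => c * f x).
Proof. by move=> hf; have := integrableZl measurableT c hf. Qed.

Lemma L1_measurable f : L1 f -> measurable_fun [set: T] f.
Proof. by move=> hf; apply/measurable_EFinP/(measurable_int P). Qed.

Lemma L1_le (f g : T -> R) : measurable_fun [set: T] f -> (forall x, `|f x| <= g x) ->
  L1 g -> L1 f.
Proof.
move=> mf fg; apply: le_integrable => //; first exact/measurable_EFinP.
by move=> x _ /=; rewrite lee_fin (le_trans (fg x))// ler_norm.
Qed.

Lemma L1_norm f : L1 f -> L1 (fun x => `|f x|).
Proof.
move=> hf; apply: (le_integrable _ _ _ hf) => //.
- by apply/measurable_EFinP/measurableT_comp => //; exact: L1_measurable.
- by move=> x _ /=; rewrite normr_id.
Qed.

Lemma Ex_cst c : \int[P]_x c = c.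
Proof.
rewrite Rintegral_cst//; transitivity (c * fine (1%E : \bar R)); last by rewrite mulr1.
by congr (_ * fine _); exact: probability_setT.
Qed.

Lemma ExD f g : L1 f -> L1 g -> \int[P]_x (f x + g x) = \int[P]_x f x + \int[P]_x g x.
Proof. exact: RintegralD. Qed.

Lemma ExB f g : L1 f -> L1 g -> \int[P]_x (f x - g x) = \int[P]_x f x - \int[P]_x g x.
Proof. exact: RintegralB. Qed.

Lemma ExZ c f : L1 f -> \int[P]_x (c * f x) = c * \int[P]_x f x.
Proof. exact: RintegralZl. Qed.

Lemma le_Ex (f g : T -> R) : L1 f -> L1 g -> (forall x, f x <= g x) ->
  \int[P]_x f x <= \int[P]_x g x.
Proof. by move=> hf hg fg; apply: le_Rintegral. Qed.

Lemma Ex_ge0 (f : T -> R) : (forall x, 0 <= f x) -> 0 <= \int[P]_x f x.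
Proof. by move=> f0; apply: Rintegral_ge0. Qed.

Lemma norm_Ex f : L1 f -> `|\int[P]_x f x| <= \int[P]_x `|f x|.
Proof. exact: le_normr_Rintegral. Qed.

Lemma EFin_Ex f : L1 f -> (\int[P]_x (f x)%:E)%E = (\int[P]_x f x)%:E.
Proof. by move=> hf; rewrite /Rintegral fineK//; apply: integrable_fin_num. Qed.

Lemma expectation_Ex f : L1 f -> ('E_P[f])%E = (\int[P]_x f x)%:E.
Proof. by move=> hf; rewrite unlock EFin_Ex. Qed.

Lemma bounded_measZ d' (T' : measurableType d') c (f : T' -> R) :
  bounded_meas f -> bounded_meas (fun x => c * f x).
Proof.
move=> [mf [B fB]]; split; first exact: measurable_funM.
by exists (`|c| * B) => x; rewrite normrM ler_wpM2l.
Qed.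

Lemma bounded_measB d' (T' : measurableType d') (f g : T' -> R) :
  bounded_meas f -> bounded_meas g -> bounded_meas (fun x => f x - g x).
Proof.
move=> [mf [B fB]] [mg [C gC]]; split; first exact: measurable_funB.
by exists (B + C) => x; rewrite (le_trans (ler_normB _ _))// lerD.
Qed.

Lemma bounded_measM d' (T' : measurableType d') (f g : T' -> R) :
  bounded_meas f -> bounded_meas g -> bounded_meas (fun x => f x * g x).
Proof.
move=> [mf [B fB]] [mg [C gC]]; split; first exact: measurable_funM.
by exists (B * C) => x; rewrite normrM ler_pM.
Qed.

Lemma bounded_meas_cst d' (T' : measurableType d') c : bounded_meas (fun _ : T' => c).
Proof. by split; [exact: measurable_cst|exists `|c|]. Qed.

Lemma bounded_meas_comp d1 d2 (T1 : measurableType d1) (T2 : measurableType d2)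
    (f : T2 -> R) (g : T1 -> T2) :
  bounded_meas f -> measurable_fun [set: T1] g -> bounded_meas (fun x => f (g x)).
Proof.
move=> [mf [B fB]] mg; split; last by exists B => x.
exact: (measurableT_comp mf mg).
Qed.

Lemma bounded_measX2 d' (T' : measurableType d') (f : T' -> R) :
  bounded_meas f -> bounded_meas (fun x => f x ^+ 2).
Proof. by move=> hf; have := bounded_measM hf hf. Qed.

End bounded_functions.

Section resampling.
Context d (T : measurableType d) (R : realType) (P : probability T R).
Context d' (T' : measurableType d') (n : nat).

Definition joint (Z : 'I_n -> {RV P >-> T'}) (w : T) : n.-tuple T' :=
  [tuple Z i w | i < n].

Definition update (z : n.-tuple T') i (y : T') : n.-tuple T' :=
  [tuple if j == i then y else tnth z j | j < n].

Lemma measurable_joint Z : measurable_fun [set: T] (joint Z).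
Proof.
apply/measurable_fun_tnthP => i.
rewrite (_ : _ \o _ = Z i); first exact: measurable_funP.
by apply/funext => w /=; rewrite tnth_mktuple.
Qed.

Lemma measurable_update i :
  measurable_fun [set: n.-tuple T' * T'] (fun zy => update zy.1 i zy.2).
Proof.
apply/measurable_fun_tnthP => j; have [ji|ji] := eqVneq j i.
  rewrite (_ : _ \o _ = snd); first exact: measurable_snd.
  by apply/funext => -[z y] /=; rewrite tnth_mktuple ji eqxx.
rewrite (_ : _ \o _ = (@tnth _ T' ^~ j) \o fst).
  exact: (measurableT_comp (measurable_tnth j) measurable_fst).
by apply/funext => -[z y] /=; rewrite tnth_mktuple (negbTE ji).
Qed.

(** Measurable boxes form a pi-system generating the product sigma-algebra, so that a
    law on tuples is determined by its values on them. *)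
Definition rectangle (A : set (n.-tuple T')) :=
  exists2 B : 'I_n -> set T', (forall i, measurable (B i)) &
    A = [set z | forall i, B i (tnth z i)].

Lemma rectangle_measurable A : rectangle A -> measurable A.
Proof.
case=> B mB ->.
rewrite (_ : mkset _ = \bigcap_(i in [set: 'I_n]) ((@tnth _ T' ^~ i) @^-1` B i)).
  apply: fin_bigcap_measurable => // i _.
  by rewrite -[X in measurable X]setTI; exact: measurable_tnth.
by apply/seteqP; split => z /= h i; [move=> _; exact: h|exact: h].
Qed.

Lemma measurable_rectangle : measurable = <<s rectangle >> :> set (set (n.-tuple T')).
Proof.
apply/seteqP; split; last first.
  apply: smallest_sub; first exact: sigma_algebra_measurable.
  exact: rectangle_measurable.
rewrite /measurable/= /g_sigma_preimage; apply: smallest_sub.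
  exact: smallest_sigma_algebra.
move=> A; rewrite -bigcup_seq/= => -[i _ [B mB <-]].
apply: sub_sigma_algebra; exists (fun j => if j == i then B : set T' else setT).
  by move=> j; case: ifP.
apply/seteqP; split => z /=.
  by move=> [_ zB] j; case: eqP => // ->.
by move=> /(_ i); rewrite eqxx.
Qed.

Lemma rectangle_setI : setI_closed rectangle.
Proof.
move=> _ _ [B mB ->] [C mC ->]; exists (fun i => B i `&` C i).
  by move=> i; exact: measurableI.
apply/seteqP; split => z /=; first by move=> [hB hC] i; split.
by move=> h; split => i; have [] := h i.
Qed.

Lemma rectangle_setT : rectangle setT.
Proof. by exists (fun=> setT) => //; apply/seteqP; split. Qed.

Variable Z : 'I_n -> {RV P >-> T'}.
Hypothesis Zindep : mutually_independent Z.

Lemma mutually_independent_rectangle (J : {set 'I_n}) (B : 'I_n -> set T') :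
  (forall i, measurable (B i)) ->
  P [set w | forall i, i \in J -> B i (Z i w)] = (\prod_(i in J) P (Z i @^-1` B i))%E.
Proof.
by move=> mB; rewrite -Zindep//.
Qed.

(** Under mutual independence, replacing one entry by an independent copy does not change
    the law of the family: both laws agree on boxes. The copy is realised as the second
    coordinate of the product space. *)
Lemma resample_integral i (F : n.-tuple T' -> \bar R) :
  measurable_fun [set: n.-tuple T'] F -> (forall z, 0 <= F z)%E ->
  (\int[P]_w F (joint Z w) = \int[P]_w \int[P]_w' F (update (joint Z w) i (Z i w')))%E.
Proof.
move=> mF F0.
pose phi (ww : T * T) := update (joint Z ww.1) i (Z i ww.2).
have mphi : measurable_fun [set: T * T] phi.
  have mg : measurable_fun [set: T * T] (fun ww => (joint Z ww.1, Z i ww.2)).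
    apply: measurable_fun_pair.
      exact: (measurableT_comp (measurable_joint Z) measurable_fst).
    exact: (measurableT_comp (@measurable_funPT _ _ _ _ (Z i)) measurable_snd).
  exact: (measurableT_comp (measurable_update i) mg).
pose mj := isMeasurableFun.Build _ _ _ _ _ (measurable_joint Z).
pose jZ : {mfun T >-> n.-tuple T'} := HB.pack (joint Z) mj.
pose mp := isMeasurableFun.Build _ _ _ _ _ mphi.
pose jphi : {mfun (T * T)%type >-> n.-tuple T'} := HB.pack phi mp.
rewrite -[LHS](@ge0_integral_pushforward _ _ _ _ _ _ (measurable_joint Z) P setT F)//.
have -> : (\int[P]_w \int[P]_w' F (update (joint Z w) i (Z i w')) =
    \int[(P \x P)%E]_ww (F \o phi) ww)%E.
  rewrite fubini_tonelli1//.
  - exact: (measurableT_comp mF mphi).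
  - by move=> ww; exact: F0.
rewrite -[RHS](@ge0_integral_pushforward _ _ _ _ _ _ mphi (P \x P)%E setT F)//.
apply: (@eq_measure_integral _ _ _ _ (pushforward (P \x P)%E jphi) (pushforward P jZ)) => A mA _.
apply: (@measure_unique _ R _ rectangle (fun=> setT) measurable_rectangle rectangle_setI _ _
   (pushforward P jZ) (pushforward (P \x P)%E jphi)) => //.
- by move=> _; exact: rectangle_setT.
- by rewrite bigcup_const.
- move=> _ [B mB ->]; rewrite /pushforward/=.
  transitivity (\prod_(j in [set: 'I_n]%SET) P (Z j @^-1` B j))%E.
    rewrite -mutually_independent_rectangle//; congr (P _).
    by apply/seteqP; split => w /= h j; have := h j; rewrite tnth_mktuple inE //; apply.
  have pE : phi @^-1` [set z | forall j, B j (tnth z j)] =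
      [set w | forall j, j \in (~: [set i])%SET -> B j (Z j w)] `*` (Z i @^-1` B i).
    apply/seteqP; split => -[w w'] /=.
      move=> h; split=> [j|]; rewrite ?inE; last by have := h i; rewrite tnth_mktuple eqxx.
      by move=> ji; have := h j; rewrite !tnth_mktuple (negbTE ji).
    move=> [h hi] j; rewrite tnth_mktuple; case: eqVneq => [->//|ji].
    by rewrite tnth_mktuple; apply: h; rewrite !inE.
  rewrite [RHS](_ : _ = (P \x P)%E (phi @^-1` [set z | forall j, B j (tnth z j)]))// pE.
  have mE1 : measurable [set w | forall j, j \in (~: [set i])%SET -> B j (Z j w)].
    rewrite (_ : mkset _ = \bigcap_(j in [set` (~: [set i])%SET]) (Z j @^-1` B j))//.
    by apply: fin_bigcap_measurable => // j _; exact: measurable_funPTI.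
  have mE2 : measurable (Z i @^-1` B i) by exact: measurable_funPTI.
  transitivity (P [set w | forall j, j \in (~: [set i])%SET -> B j (Z j w)]
                * P (Z i @^-1` B i))%E; last by rewrite product_measure1E.
  rewrite mutually_independent_rectangle// muleC.
  rewrite (bigD1 i) ?inE//=; congr (_ * _)%E.
  by apply: eq_bigl => j; rewrite !inE.
- move=> _; have : (P [set: T] < +oo)%E by rewrite (@probability_setT _ _ _ P) ltry.
  by [].
Qed.

End resampling.

(** * The Efron-Stein inequality and the replacement argument *)

Section conditional_mean.
Context d (T : measurableType d) (R : realType) (P : probability T R).
Context d' (T' : measurableType d') (n : nat).
Implicit Types (F G H : n.-tuple T' -> R) (z : n.-tuple T').

(** The conditional expectation of [F] given all coordinates but [i], written as a function
    of the whole tuple that ignores coordinate [i]. *)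
Definition coord_mean (W : T -> T') i F z : R := \int[P]_w F (update z i (W w)).

Definition free_of i F := forall z y, F (update z i y) = F z.

Lemma update_update z i y y' : update (update z i y) i y' = update z i y'.
Proof.
by apply: eq_from_tnth => j; rewrite !tnth_mktuple; case: ifP => // ji; rewrite ji.
Qed.

Lemma updateC z i j y y' : i != j -> update (update z i y) j y' = update (update z j y') i y.
Proof.
move=> ij; apply: eq_from_tnth => k; rewrite !tnth_mktuple.
by case: (eqVneq k j) => // ->; rewrite eq_sym (negbTE ij).
Qed.

Lemma free_coord_mean W i F : free_of i (coord_mean W i F).
Proof. by move=> z y; apply: eq_Rintegral => w _; rewrite update_update. Qed.

Lemma free_coord_mean_preserved W i j F : free_of j F -> free_of j (coord_mean W i F).
Proof.
move=> Fj; have [->|ij] := eqVneq i j; first exact: free_coord_mean.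
by move=> z y; apply: eq_Rintegral => w _; rewrite updateC 1?eq_sym// Fj.
Qed.

Section fixed_coordinate.
Variables (W : {mfun T >-> T'}) (i : 'I_n).
Local Notation E := (coord_mean W i).

Lemma bounded_meas_section F z : bounded_meas F -> bounded_meas (fun w => F (update z i (W w))).
Proof.
move=> hF; apply: (bounded_meas_comp hF).
have m2 : measurable_fun [set: T] (fun w => (z, W w) : n.-tuple T' * T').
  by apply: measurable_fun_pair => //; exact: measurable_funPT.
exact: (measurableT_comp (measurable_update i) m2).
Qed.

Lemma L1_section F z : bounded_meas F -> L1 P (fun w => F (update z i (W w))).
Proof. by move=> hF; apply/bounded_meas_L1/bounded_meas_section. Qed.

Lemma bounded_meas_coord_mean F : bounded_meas F -> bounded_meas (E F).
Proof.
move=> hF; have [mF [B FB]] := hF; split; last first.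
  exists B => z; rewrite (le_trans (norm_Ex (L1_section z hF)))//.
  rewrite -[leRHS](Ex_cst P); apply: le_Ex => //.
  - exact/L1_norm/L1_section.
  - exact: L1_cst.
(* Tonelli applies to the nonnegative function [F + B]. *)
have mG : measurable_fun [set: n.-tuple T' * T] (fun zw => (F (update zw.1 i (W zw.2)) + B)%:E).
  apply/measurable_EFinP; apply: measurable_funD => //.
  have m2 : measurable_fun [set: n.-tuple T' * T] (fun zw => (zw.1, W zw.2)).
    apply: measurable_fun_pair => //.
    exact: (measurableT_comp (@measurable_funPT _ _ _ _ W) measurable_snd).
  exact: (measurableT_comp mF (measurableT_comp (measurable_update i) m2)).
have G0 zw : (0 <= (F (update zw.1 i (W zw.2)) + B)%:E)%E.
  rewrite lee_fin -lerBlDr sub0r.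
  by have := FB (update zw.1 i (W zw.2)); rewrite ler_norml => /andP[].
have := measurable_fun_fubini_tonelli_F (m2 := P) _ mG G0.
have -> : fubini_F P (fun zw => (F (update zw.1 i (W zw.2)) + B)%:E) = EFin \o (fun z => E F z + B).
  apply/funext => z; rewrite /fubini_F /= EFin_Ex; last first.
    by apply: L1D; [exact: L1_section|exact: L1_cst].
  by rewrite ExD ?Ex_cst//; [exact: L1_section|exact: L1_cst].
move/measurable_EFinP => m.
rewrite (_ : E F = fun z => E F z + B - B); last by apply/funext => z; rewrite addrK.
exact: measurable_funB.
Qed.

Lemma coord_meanB F G z : bounded_meas F -> bounded_meas G ->
  E (fun z => F z - G z) z = E F z - E G z.
Proof. by move=> hF hG; rewrite /coord_mean ExB//; exact: L1_section. Qed.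

Lemma coord_meanMr F H z : bounded_meas F -> free_of i H -> E (fun z => F z * H z) z = E F z * H z.
Proof.
move=> hF Hi; rewrite /coord_mean mulrC -ExZ; last exact: L1_section.
by apply: eq_Rintegral => w _; rewrite Hi mulrC.
Qed.

End fixed_coordinate.

Section independent.
Variable Z : 'I_n -> {RV P >-> T'}.
Hypothesis Zindep : mutually_independent Z.
Local Notation E i := (coord_mean (Z i) i).
Local Notation mean F := (\int[P]_w F (joint Z w)).

Lemma bounded_meas_joint F : bounded_meas F -> bounded_meas (fun w => F (joint Z w)).
Proof. by move=> hF; apply: (bounded_meas_comp hF); exact: measurable_joint. Qed.

Lemma L1_joint F : bounded_meas F -> L1 P (fun w => F (joint Z w)).
Proof. by move=> hF; exact/bounded_meas_L1/bounded_meas_joint. Qed.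

Lemma mean_coord_mean i F : bounded_meas F -> mean (E i F) = mean F.
Proof.
move=> hF; have [mF [B FB]] := hF.
have := @resample_integral _ _ _ P _ _ _ Z Zindep i (fun z => (F z + B)%:E).
have L1F := L1_joint hF.
have L1E := L1_joint (bounded_meas_coord_mean (Z i) i hF).
rewrite EFin_Ex ?ExD ?Ex_cst//; [|exact: L1_cst|by apply: L1D => //; exact: L1_cst].
have -> : (\int[P]_w \int[P]_w' (F (update (joint Z w) i (Z i w')) + B)%:E =
  \int[P]_w (E i F (joint Z w) + B)%:E)%E.
  apply: eq_integral => w _; rewrite EFin_Ex; last first.
    by apply: L1D; [exact: L1_section|exact: L1_cst].
  by rewrite ExD ?Ex_cst//; [exact: L1_section|exact: L1_cst].
rewrite EFin_Ex ?ExD ?Ex_cst//; [|exact: L1_cst|by apply: L1D => //; exact: L1_cst].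
move=> h; apply/esym/(@addIr _ B)/EFin_inj; apply: h.
  by apply/measurable_EFinP; exact: measurable_funD.
by move=> z; rewrite lee_fin -lerBlDr sub0r; have := FB z; rewrite ler_norml => /andP[].
Qed.

Lemma meanM_coord_mean i F H : bounded_meas F -> bounded_meas H -> free_of i H ->
  mean (fun z => F z * H z) = mean (fun z => E i F z * H z).
Proof.
move=> hF hH Hi; rewrite -(mean_coord_mean i); last exact: bounded_measM.
by apply: eq_Rintegral => w _; rewrite coord_meanMr.
Qed.

Lemma mean_sqrB F G : bounded_meas F -> bounded_meas G ->
  mean (fun z => (F z - G z) ^+ 2) =
  mean (fun z => F z ^+ 2) - 2 * mean (fun z => F z * G z) + mean (fun z => G z ^+ 2).
Proof.
move=> hF hG.
have hFF := L1_joint (bounded_measX2 hF); have hGG := L1_joint (bounded_measX2 hG).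
have hFG := L1_joint (bounded_measM hF hG).
rewrite -ExZ// -ExB//; last exact: L1Z.
rewrite -ExD//; last by apply: L1B => //; exact: L1Z.
by apply: eq_Rintegral => w _; ring.
Qed.

(** Pythagoras: averaging over a coordinate is an orthogonal projection. *)
Lemma mean_sqr_sub_coord_mean i F : bounded_meas F ->
  mean (fun z => (F z - E i F z) ^+ 2) =
  mean (fun z => F z ^+ 2) - mean (fun z => E i F z ^+ 2).
Proof.
move=> hF; have hE := bounded_meas_coord_mean (Z i) i hF.
rewrite mean_sqrB// (meanM_coord_mean hF hE (@free_coord_mean _ _ _)).
have -> : mean (fun z => E i F z * E i F z) = mean (fun z => E i F z ^+ 2) by [].
by ring.
Qed.

Lemma coord_mean_closest i F H : bounded_meas F -> bounded_meas H -> free_of i H ->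
  mean (fun z => (F z - E i F z) ^+ 2) <= mean (fun z => (F z - H z) ^+ 2).
Proof.
move=> hF hH Hi; have hE := bounded_meas_coord_mean (Z i) i hF.
rewrite mean_sqr_sub_coord_mean// mean_sqrB// (meanM_coord_mean hF hH Hi).
have : 0 <= mean (fun z => (E i F z - H z) ^+ 2) by apply: Ex_ge0 => w; exact: sqr_ge0.
rewrite mean_sqrB//; lra.
Qed.

Lemma mean_coord_mean_sqr i F : bounded_meas F ->
  mean (fun z => E i F z ^+ 2) <= mean (fun z => F z ^+ 2).
Proof.
move=> hF; rewrite -subr_ge0 -mean_sqr_sub_coord_mean//.
by apply: Ex_ge0 => w; exact: sqr_ge0.
Qed.

(** Averaging over one coordinate does not increase the fluctuation along another:
    [E_i (E_j F)] is free of coordinate [j] and [E_i] contracts the second moment. *)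
Lemma fluctuation_coord_mean i j F : bounded_meas F ->
  mean (fun z => (E i F z - E j (E i F) z) ^+ 2) <= mean (fun z => (F z - E j F z) ^+ 2).
Proof.
move=> hF; have hE k G : bounded_meas G -> bounded_meas (E k G) by exact: bounded_meas_coord_mean.
have Hj : free_of j (E i (E j F)).
  by apply: free_coord_mean_preserved; exact: free_coord_mean.
apply: le_trans (coord_mean_closest (hE i _ hF) (hE i _ (hE j _ hF)) Hj) _.
have hB : bounded_meas (fun z => F z - E j F z) by apply: bounded_measB => //; exact: hE.
apply: le_trans (mean_coord_mean_sqr i hB); rewrite le_eqVlt; apply/orP; left; apply/eqP.
by apply: eq_Rintegral => w _; rewrite coord_meanB//; exact: hE.
Qed.

Fixpoint coord_means (s : seq 'I_n) F := if s is i :: s' then coord_means s' (E i F) else F.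

Lemma mean_coord_means s F : bounded_meas F -> mean (coord_means s F) = mean F.
Proof.
elim: s F => //= i s IH F hF; rewrite IH ?mean_coord_mean//; exact: bounded_meas_coord_mean.
Qed.

Lemma free_coord_means s F j : (j \in s) || `[< free_of j F >] -> free_of j (coord_means s F).
Proof.
elim: s F => [|i s IH] F /=; first by move/asboolP.
rewrite inE -orbA => h; apply: IH; move: h => /or3P[/eqP ->|->//|/asboolP h].
  by apply/orP; right; apply/asboolP/free_coord_mean.
by apply/orP; right; apply/asboolP/free_coord_mean_preserved.
Qed.

(** Change the coordinates of [z] into those of [z'] one after the other. *)
Lemma free_of_all F : (forall i, free_of i F) -> forall z z', F z = F z'.
Proof.
move=> hF z z'.
suff h k : F [tuple if (i < k)%N then tnth z' i else tnth z i | i < n] = F z.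
  rewrite -(h n); congr F; apply: eq_from_tnth => i.
  by rewrite tnth_mktuple ltn_ord.
elim: k => [|k IH].
  by congr F; apply: eq_from_tnth => i; rewrite tnth_mktuple.
have [kn|kn] := ltnP k n; last first.
  rewrite -IH; congr F; apply: eq_from_tnth => i; rewrite !tnth_mktuple ltnS.
  by rewrite (leq_trans (ltnW (ltn_ord i)) kn) (leq_trans (ltn_ord i) kn).
rewrite -IH -[RHS](hF (Ordinal kn) _ (tnth z' (Ordinal kn))); congr F.
apply: eq_from_tnth => i; rewrite !tnth_mktuple ltnS leq_eqVlt.
case: (eqVneq i (Ordinal kn)) => [->|ik]; first by rewrite eqxx.
have -> : (nat_of_ord i == k) = false; last by [].
by apply/negbTE; apply: contra ik => /eqP ik; apply/eqP/val_inj.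
Qed.

(** Averaging out the coordinates one after the other loses at each step a second moment
    which, by [fluctuation_coord_mean], is at most the fluctuation of [F] itself. *)
Lemma mean_sqr_coord_means (V : 'I_n -> R) s F : bounded_meas F ->
  (forall i, mean (fun z => (F z - E i F z) ^+ 2) <= V i) ->
  mean (fun z => F z ^+ 2) <= \sum_(i <- s) V i + mean (fun z => coord_means s F z ^+ 2).
Proof.
elim: s F => [|i s IH] F hF hV /=; first by rewrite big_nil add0r.
have := IH _ (bounded_meas_coord_mean (Z i) i hF)
  (fun j => le_trans (fluctuation_coord_mean i j hF) (hV j)).
have := hV i; rewrite mean_sqr_sub_coord_mean// big_cons; lra.
Qed.

(** The Efron-Stein inequality, in the form where the mean along coordinate [i] may be
    replaced by any constant, which may depend on the other coordinates. After all
    coordinates have been averaged out in [mean_sqr_coord_means], only the squared mean is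
    left. *)
Lemma efron_stein (V : 'I_n -> R) F : bounded_meas F ->
  (forall i z, exists c, \int[P]_w (F (update z i (Z i w)) - c) ^+ 2 <= V i) ->
  \int[P]_w (F (joint Z w) - mean F) ^+ 2 <= \sum_i V i.
Proof.
move=> hF hV.
have hE k G : bounded_meas G -> bounded_meas (E k G) by exact: bounded_meas_coord_mean.
have hi i : mean (fun z => (F z - E i F z) ^+ 2) <= V i.
  have hD : bounded_meas (fun z => (F z - E i F z) ^+ 2).
    by apply: bounded_measX2; apply: bounded_measB => //; exact: hE.
  rewrite -[leLHS](mean_coord_mean i hD) -[leRHS](Ex_cst P).
  apply: le_Ex; [by apply: L1_joint; exact: hE|exact: L1_cst|].
  move=> w; set z := joint Z w; have [c hc] := hV i z.
  apply: le_trans hc.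
  have -> : E i (fun z => (F z - E i F z) ^+ 2) z =
            \int[P]_w (F (update z i (Z i w)) - E i F z) ^+ 2.
    by apply: eq_Rintegral => u _; rewrite free_coord_mean.
  set f := fun w => F (update z i (Z i w)).
  have hf : bounded_meas f by exact: bounded_meas_section.
  have sq b : \int[P]_w (f w - b) ^+ 2 =
      \int[P]_w (f w ^+ 2) - 2 * b * \int[P]_w f w + b ^+ 2.
    have L1f := bounded_meas_L1 P hf; have L1ff := bounded_meas_L1 P (bounded_measX2 hf).
    rewrite -ExZ// -ExB//; last exact: L1Z.
    rewrite -[b ^+ 2](Ex_cst P) -ExD; [|by apply: L1B => //; exact: L1Z|exact: L1_cst].
    by apply: eq_Rintegral => u _; ring.
  rewrite !sq; set m := E i F z.
  have -> : \int[P]_w f w = m by [].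
  by have := sqr_ge0 (m - c); lra.
have := mean_sqr_coord_means (index_enum 'I_n) hF hi.
pose s := index_enum 'I_n; rewrite -/s.
have fr i : free_of i (coord_means s F) by apply: free_coord_means; rewrite mem_index_enum.
have cE w : coord_means s F (joint Z w) = mean F.
  rewrite -(mean_coord_means s hF) -[LHS](Ex_cst P).
  by apply: eq_Rintegral => w' _; exact: free_of_all.
have -> : mean (fun z => coord_means s F z ^+ 2) = mean F ^+ 2.
  by rewrite -[RHS](Ex_cst P); apply: eq_Rintegral => w _; rewrite cE.
have := @mean_sqrB F (fun=> mean F) hF (bounded_meas_cst _ _); rewrite Ex_cst => ->.
have -> : \int[P]_w (F (joint Z w) * mean F) = mean F * mean F.
  under eq_Rintegral do rewrite mulrC; rewrite ExZ//; exact: L1_joint.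
by lra.
Qed.

End independent.

Section replacement.
Variables X Y : 'I_n -> {RV P >-> T'}.
Hypotheses (Xindep : mutually_independent X) (Yindep : mutually_independent Y).
Hypothesis XYindep : independent_families X Y.

Definition hybrid k (i : 'I_n) : {RV P >-> T'} := if (i < k)%N then X i else Y i.

Lemma rectangle_in_measurable (J : {set 'I_n}) (B : 'I_n -> set T') :
  (forall i, i \in J -> measurable (B i)) ->
  measurable [set z : n.-tuple T' | forall i, i \in J -> B i (tnth z i)].
Proof.
move=> mB.
rewrite (_ : mkset _ = \bigcap_(i in [set` J]) ((@tnth _ T' ^~ i) @^-1` B i))//.
apply: fin_bigcap_measurable => // i iJ.
by rewrite -[X in measurable X]setTI; apply: measurable_tnth => //; exact: mB.
Qed.

(** The coordinates taken from [X] and those taken from [Y] are independent of each other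
    because events of the two whole families are. *)
Lemma hybrid_independent k : mutually_independent (hybrid k).
Proof.
move=> J B mB.
pose J1 := (J :&: [set i : 'I_n | (i < k)%N])%SET.
pose J2 := (J :\: [set i : 'I_n | (i < k)%N])%SET.
have mB1 i : i \in J1 -> measurable (B i) by rewrite inE => /andP[/mB].
have mB2 i : i \in J2 -> measurable (B i) by rewrite inE => /andP[_ /mB].
have := XYindep (rectangle_in_measurable mB1) (rectangle_in_measurable mB2).
have e1 : [set w | [set z : n.-tuple T' | forall i, i \in J1 -> B i (tnth z i)]
                [tuple X i w | i < n]]
   = \bigcap_(i in [set` J1]) (X i @^-1` B i).
  by apply/seteqP; split => w /= h i /h; rewrite tnth_mktuple.
have e2 : [set w | [set z : n.-tuple T' | forall i, i \in J2 -> B i (tnth z i)]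
                [tuple Y i w | i < n]]
   = \bigcap_(i in [set` J2]) (Y i @^-1` B i).
  by apply/seteqP; split => w /= h i /h; rewrite tnth_mktuple.
rewrite e1 e2 Xindep// Yindep// => h.
transitivity (\prod_(i in J1) P (X i @^-1` B i) * \prod_(i in J2) P (Y i @^-1` B i))%E.
  rewrite -h; congr (P _); apply/seteqP; split => w /=.
    move=> hw; split=> i /=; rewrite !inE => /andP[].
      by move=> iJ ik; have := hw i iJ; rewrite /hybrid ik.
    by move=> /negbTE ik iJ; have := hw i iJ; rewrite /hybrid ik.
  move=> [h1 h2] i /= iJ; rewrite /hybrid; case: ifPn => ik.
    by apply: h1; rewrite /= !inE ik andbT.
  by apply: h2; rewrite /= !inE ik.
rewrite [RHS](bigID (fun i : 'I_n => (i < k)%N))/=; congr (_ * _)%E.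
  apply: eq_big => [i|i]; rewrite ?inE// => /andP[_ ik].
  by rewrite /hybrid ik.
apply: eq_big => [i|i]; rewrite ?inE 1?andbC// => /andP[_ /negbTE ik].
by rewrite /hybrid ik.
Qed.

(** Lindeberg's replacement argument. Consecutive hybrids differ only in coordinate [i];
    once that coordinate has been averaged out, by the law of [X i] in one and of [Y i] in
    the other, both integrands are functions of the same remaining coordinates. *)
Lemma lindeberg (U : 'I_n -> R) F : bounded_meas F ->
  (forall i z, `|\int[P]_w F (update z i (X i w)) - \int[P]_w F (update z i (Y i w))| <= U i) ->
  `|\int[P]_w F (joint X w) - \int[P]_w F (joint Y w)| <= \sum_i U i.
Proof.
move=> hF hU.
pose e k := \int[P]_w F (joint (hybrid k) w).
have eX : \int[P]_w F (joint X w) = e n.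
  apply: eq_Rintegral => w _; congr F.
  by apply: eq_from_tnth => i; rewrite !tnth_mktuple /hybrid ltn_ord.
have eY : \int[P]_w F (joint Y w) = e 0%N.
  by apply: eq_Rintegral => w _; congr F; apply: eq_from_tnth => i; rewrite !tnth_mktuple.
rewrite eX eY -(telescope_sumr e (leq0n n)) big_mkord.
apply: (le_trans (ler_norm_sum _ _ _)); apply: ler_sum => i _.
have hyX : hybrid i.+1 i = X i by rewrite /hybrid ltnS leqnn.
have hyY : hybrid i i = Y i by rewrite /hybrid ltnn.
rewrite /e -(mean_coord_mean (hybrid_independent i.+1) i hF).
rewrite -(mean_coord_mean (hybrid_independent i) i hF).
rewrite hyX hyY.
have -> : \int[P]_w coord_mean (X i) i F (joint (hybrid i.+1) w) =
          \int[P]_w coord_mean (X i) i F (joint (hybrid i) w).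
  apply: eq_Rintegral => w _.
  rewrite -[LHS](free_coord_mean _ _ _ _ (tnth (joint (hybrid i) w) i)); congr coord_mean.
  apply: eq_from_tnth => j; rewrite !tnth_mktuple; case: eqVneq => [->//|ji].
  by rewrite /hybrid ltnS leq_eqVlt (_ : (nat_of_ord j == i) = false)//; apply/negbTE.
have L W : L1 P (fun w => coord_mean (W : {mfun T >-> T'}) i F (joint (hybrid i) w)).
  by apply: L1_joint; exact: bounded_meas_coord_mean.
rewrite -ExB// (le_trans (norm_Ex _))//; first exact: L1B.
rewrite -[leRHS](Ex_cst P); apply: le_Ex; [exact/L1_norm/L1B|exact: L1_cst|].
by move=> w; exact: hU.
Qed.

End replacement.

End conditional_mean.

(** * Pointwise estimates for the increment *)

Section pointwise.
Context {R : realType}.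
Implicit Types a m s c q : R.

Lemma shrink_le1 c : 0 <= c -> 0 < (1 + c)^-1 <= 1.
Proof.
by move=> c0; rewrite invr_gt0 ltr_wpDr//= invf_le1 ?ltr_wpDr// lerDl.
Qed.

Lemma shrink_sqr_le1 c q : 0 <= q <= c -> 0 <= q / (1 + c) ^+ 2 <= 1.
Proof.
move=> /andP[q0 qc]; have c0 := le_trans q0 qc.
have p0 : 0 < (1 + c) ^+ 2 by rewrite exprn_gt0// ltr_wpDr.
rewrite divr_ge0 ?(ltW p0)//= ler_pdivrMr// mul1r; nra.
Qed.

Lemma shrink_dist_le1 c c' : 0 <= c -> 0 <= c' -> `|(1 + c)^-1 - (1 + c')^-1| <= 1.
Proof.
move=> /shrink_le1 /andP[h1 h2] /shrink_le1 /andP[h3 h4].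
by rewrite ler_norml; apply/andP; split; lra.
Qed.

Lemma shrink_dist c c' : 0 <= c -> 0 <= c' -> `|(1 + c)^-1 - (1 + c')^-1| <= `|c - c'|.
Proof.
move=> c0 c0'; have /andP[h1 h2] := shrink_le1 c0; have /andP[h3 h4] := shrink_le1 c0'.
have -> : (1 + c)^-1 - (1 + c')^-1 = (c' - c) * ((1 + c)^-1 * (1 + c')^-1).
  by field; rewrite !gt_eqF ?ltr_wpDr.
rewrite normrM distrC ler_piMr// ger0_norm; last by rewrite mulr_ge0 ?ltW.
by apply: mulr_ile1; rewrite // ltW.
Qed.

Lemma shrink_sqr_dist_le1 c q c' q' : 0 <= q <= c -> 0 <= q' <= c' ->
  `|q / (1 + c) ^+ 2 - q' / (1 + c') ^+ 2| <= 1.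
Proof.
move=> /shrink_sqr_le1 /andP[h1 h2] /shrink_sqr_le1 /andP[h3 h4].
by rewrite ler_norml; apply/andP; split; lra.
Qed.

(** The bound does not involve the size of [q'], because, with
    [r = 1 / (1 + c)] and [r' = 1 / (1 + c')], one has [r - r' = (c' - c) r r'] and [q' r' <= 1]. *)
Lemma shrink_sqr_dist c q c' q' : 0 <= q <= c -> 0 <= q' <= c' ->
  `|q / (1 + c) ^+ 2 - q' / (1 + c') ^+ 2| <= `|q - q'| + 2 * `|c - c'|.
Proof.
move=> /andP[q0 qc] /andP[q0' qc'].
have c0 := le_trans q0 qc; have c0' := le_trans q0' qc'.
have /andP[h1 h2] := shrink_le1 c0; have /andP[h3 h4] := shrink_le1 c0'.
have r0 : 0 < 1 + c by rewrite ltr_wpDr.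
have r0' : 0 < 1 + c' by rewrite ltr_wpDr.
have -> : q / (1 + c) ^+ 2 - q' / (1 + c') ^+ 2 =
   (q - q') * (1 + c)^-1 ^+ 2
   + (c' - c) * ((1 + c)^-1 * (q' * (1 + c')^-1) * ((1 + c)^-1 + (1 + c')^-1)).
  by field; rewrite !gt_eqF.
set r := (1 + c)^-1 in h1 h2 *; set r' := (1 + c')^-1 in h3 h4 *.
have q'r' : 0 <= q' * r' <= 1.
  by rewrite divr_ge0 ?(ltW r0')//= ler_pdivrMr// mul1r; lra.
move/andP: q'r' => [x0 x1]; set x := q' * r' in x0 x1 *.
apply: le_trans (ler_normD _ _) _; apply: lerD; rewrite normrM.
  rewrite ler_piMr// ger0_norm; last by rewrite sqr_ge0.
  by rewrite expr_le1// ltW.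
rewrite distrC mulrC ler_wpM2r// ger0_norm; last by rewrite !mulr_ge0 ?addr_ge0 ?(ltW h1) ?(ltW h3).
rewrite -[2]mul1r; apply: ler_pM; rewrite ?mulr_ge0 ?addr_ge0 ?(ltW h1) ?(ltW h3)//.
  by apply: mulr_ile1; rewrite // ltW.
lra.
Qed.

Lemma sum5_sqr (x1 x2 x3 x4 x5 : R) :
  (x1 + x2 + x3 + x4 + x5) ^+ 2 <= 5 * (x1 ^+ 2 + x2 ^+ 2 + x3 ^+ 2 + x4 ^+ 2 + x5 ^+ 2).
Proof.
rewrite -subr_ge0.
have -> : 5 * (x1 ^+ 2 + x2 ^+ 2 + x3 ^+ 2 + x4 ^+ 2 + x5 ^+ 2) - (x1 + x2 + x3 + x4 + x5) ^+ 2
  = (x1 - x2) ^+ 2 + (x1 - x3) ^+ 2 + (x1 - x4) ^+ 2 + (x1 - x5) ^+ 2 + (x2 - x3) ^+ 2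
  + (x2 - x4) ^+ 2 + (x2 - x5) ^+ 2 + (x3 - x4) ^+ 2 + (x3 - x5) ^+ 2 + (x4 - x5) ^+ 2 by ring.
by rewrite !addr_ge0 ?sqr_ge0.
Qed.

Lemma mulr_sqr_le1 (x r : R) : 0 <= r <= 1 -> (x * r) ^+ 2 <= x ^+ 2.
Proof.
by move=> /andP[r0 r1]; rewrite exprMn ler_piMr ?sqr_ge0// expr_le1.
Qed.

(** Distance of the increment to its value at [m = s = 0], [c = c'], [q = q']. Only the
    term of weight [a ^+ 4] involves the fluctuations of the quadratic statistics. *)
Lemma loo_increment_sqr a m s c q c' q' : 0 <= q <= c -> 0 <= q' <= c' ->
  (loo_increment a m s c q - a ^+ 2 * (q' / (1 + c') ^+ 2)) ^+ 2 <=
  5 * (4 * a ^+ 2 * s ^+ 2 + 2 * (m ^+ 4 + s ^+ 4) + 4 * a ^+ 2 * m ^+ 2 + m ^+ 4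
       + a ^+ 4 * (q / (1 + c) ^+ 2 - q' / (1 + c') ^+ 2) ^+ 2).
Proof.
move=> qc qc'; have /andP[q0 q_c] := qc; have c0 := le_trans q0 q_c.
have /andP[/ltW h1 h2] := shrink_le1 c0; have hu := shrink_sqr_le1 qc.
have -> : loo_increment a m s c q - a ^+ 2 * (q' / (1 + c') ^+ 2) =
   2 * a * s * (1 + c)^-1 + (- 2 * m * s) * (1 + c)^-1
   + (- 2 * a * m) * (q / (1 + c) ^+ 2) + m ^+ 2 * (q / (1 + c) ^+ 2)
   + a ^+ 2 * (q / (1 + c) ^+ 2 - q' / (1 + c') ^+ 2).
  rewrite /loo_increment -!exprVn; ring.
apply: le_trans (sum5_sqr _ _ _ _ _) _; rewrite ler_pM2l//.
have hr : 0 <= (1 + c)^-1 <= 1 by rewrite h1.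
have b1 := mulr_sqr_le1 (2 * a * s) hr; have b2 := mulr_sqr_le1 (- 2 * m * s) hr.
have b3 := mulr_sqr_le1 (- 2 * a * m) hu; have b4 := mulr_sqr_le1 (m ^+ 2) hu.
have b5 : (- 2 * m * s) ^+ 2 <= 2 * (m ^+ 4 + s ^+ 4).
  by have := sqr_ge0 (m ^+ 2 - s ^+ 2); nra.
rewrite [(a ^+ 2 * _) ^+ 2]exprMn -exprM; apply: lerD => //.
have -> : m ^+ 4 = (m ^+ 2) ^+ 2 by rewrite -exprM.
rewrite -exprM in b4 *; nra.
Qed.

(** Freezing the quadratic statistics at the levels [c'], [q'] makes the increment a
    quadratic polynomial in [m] and [s]. *)
Lemma loo_increment_dist a m s c q c' q' u v :
  u = (1 + c)^-1 - (1 + c')^-1 ->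
  v = q / (1 + c) ^+ 2 - q' / (1 + c') ^+ 2 ->
  `|loo_increment a m s c q
    - (2 * (1 + c')^-1 * ((a - m) * s) + q' / (1 + c') ^+ 2 * (a - m) ^+ 2)|
  <= 2 * (`|a| * (`|s| * `|u|) + `|m * s| * `|u|) + 2 * (a ^+ 2 + m ^+ 2) * `|v|.
Proof.
move=> uE vE.
have -> : loo_increment a m s c q
    - (2 * (1 + c')^-1 * ((a - m) * s) + q' / (1 + c') ^+ 2 * (a - m) ^+ 2)
  = 2 * ((a - m) * s * u) + (a - m) ^+ 2 * v.
  by rewrite /loo_increment uE vE -!exprVn; ring.
apply: le_trans (ler_normD _ _) _; apply: lerD.
  rewrite !normrM ger0_norm// ler_pM2l// !mulrA -mulrDl -mulrDl !ler_wpM2r//.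
  by rewrite (le_trans (ler_normB _ _)).
rewrite normrM ler_wpM2r// ger0_norm ?sqr_ge0//.
have -> : 2 * (a ^+ 2 + m ^+ 2) = (a - m) ^+ 2 + (a + m) ^+ 2 by ring.
by rewrite lerDl sqr_ge0.
Qed.

End pointwise.

(** * Moments of the increment *)

(** [1 / f = f / f^2], and the inverse of the positive function [f^2] is the exponential of
    [- ln (f^2)]. *)
Lemma measurable_inv d (T : measurableType d) (R : realType) (f : T -> R) :
  measurable_fun [set: T] f -> (forall x, f x != 0) ->
  measurable_fun [set: T] (fun x => (f x)^-1).
Proof.
move=> mf f0.
have -> : (fun x => (f x)^-1) = (fun x => f x * expR (- ln (f x ^+ 2))).
  apply/funext => x; rewrite expRN lnK ?posrE ?exprn_even_gt0 ?f0//.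
  by field.
have ml : measurable_fun [set: T] (fun x => ln (f x ^+ 2)).
  exact: (measurableT_comp (@measurable_ln R) (measurable_funX 2 mf)).
exact: (measurable_funM mf (measurableT_comp (@measurable_expR R) (measurable_funN ml))).
Qed.

Section moments.
Context d (T : measurableType d) (R : realType) (P : probability T R).
Implicit Types f g : T -> R.

Definition moment_le k f (b : R) :=
  [/\ measurable_fun [set: T] f, L1 P (fun w => f w ^+ k) & \int[P]_w (f w ^+ k) <= b].

Lemma L1_mul_sqr f g : measurable_fun [set: T] f -> measurable_fun [set: T] g ->
  L1 P (fun w => f w ^+ 2) -> L1 P (fun w => g w ^+ 2) -> L1 P (fun w => f w * g w).
Proof.
move=> mf mg hf hg; apply: L1_le (L1D hf hg); first exact: measurable_funM.
move=> w; rewrite normrM -[f w ^+ 2]real_normK ?num_real// -[g w ^+ 2]real_normK ?num_real//.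
have := sqr_ge0 (`|f w| - `|g w|); have := sqr_ge0 (`|f w| + `|g w|); nra.
Qed.

Lemma moment2_ge0 f b : moment_le 2 f b -> 0 <= b.
Proof. by case=> _ _; apply: le_trans; apply: Ex_ge0 => w; exact: sqr_ge0. Qed.

(** Cauchy-Schwarz, from the discriminant of [E (x |f| + y |g|)^2]. *)
Lemma moment2_mul f g b b' : moment_le 2 f b -> moment_le 2 g b' ->
  L1 P (fun w => `|f w| * `|g w|) /\
  \int[P]_w (`|f w| * `|g w|) <= Num.sqrt b * Num.sqrt b'.
Proof.
move=> hf hg; have b0 := moment2_ge0 hf; have b0' := moment2_ge0 hg.
case: hf hg => mf Lf Ef [mg Lg Eg].
have Lfg : L1 P (fun w => `|f w| * `|g w|).
  by have := L1_norm (L1_mul_sqr mf mg Lf Lg); under eq_fun do rewrite normrM.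
split=> //.
set e := \int[P]_w _; have e0 : 0 <= e by apply: Ex_ge0 => w; rewrite mulr_ge0.
rewrite -sqrtrM// -[e]ger0_norm// -sqrtr_sqr ler_sqrt ?mulr_ge0//.
apply: le_trans (_ : \int[P]_w (f w ^+ 2) * \int[P]_w (g w ^+ 2) <= _); last first.
  by apply: ler_pM => //; apply: Ex_ge0 => w; exact: sqr_ge0.
apply: discriminant_le0 => [|x y]; first by apply: Ex_ge0 => w; exact: sqr_ge0.
rewrite -!ExZ// -!ExD//; try by do ?[apply: L1D|apply: L1Z].
apply: Ex_ge0 => w; have := sqr_ge0 (x * `|f w| + y * `|g w|).
rewrite sqrrD !exprMn !real_normK ?num_real// => h.
by apply: le_trans h _; rewrite le_eqVlt; apply/orP; left; apply/eqP; ring.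
Qed.

Lemma moment2_cst c : moment_le 2 (fun=> c) (c ^+ 2).
Proof. by split; [exact: measurable_cst|exact: L1_cst|rewrite Ex_cst]. Qed.

Lemma moment2_norm f b : moment_le 2 f b ->
  L1 P (fun w => `|f w|) /\ \int[P]_w `|f w| <= Num.sqrt b.
Proof.
move=> hf; have [] := moment2_mul hf (moment2_cst 1).
rewrite expr1n sqrtr1 mulr1 => h1 h2; split.
  by move: h1; under eq_fun do rewrite normr1 mulr1.
by move: h2; under eq_Rintegral do rewrite normr1 mulr1.
Qed.

Variables (m s c q : T -> R) (a tau l2 l4 q2 : R).
Hypotheses (tau0 : 0 <= tau) (l20 : 0 <= l2) (l40 : 0 <= l4) (q20 : 0 <= q2).
Hypothesis qc : forall w, 0 <= q w <= c w.
Hypotheses (m2 : moment_le 2 m (tau * l2)) (s2 : moment_le 2 s (tau * l2)).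
Hypotheses (m4 : moment_le 4 m (tau ^+ 2 * l4)) (s4 : moment_le 4 s (tau ^+ 2 * l4)).
Hypotheses (L1c : L1 P c) (L1q : L1 P q).
Let c' := \int[P]_w c w.
Let q' := \int[P]_w q w.
Hypothesis c2 : moment_le 2 (fun w => c w - c') (tau ^+ 2 * q2).
Hypothesis q2' : moment_le 2 (fun w => q w - q') (tau ^+ 2 * q2).

Let qc' : 0 <= q' <= c'.
Proof.
apply/andP; split; first by apply: Ex_ge0 => w; have /andP[] := qc w.
by apply: le_Ex => // w; have /andP[] := qc w.
Qed.

Let c_ge0 w : 0 <= c w. Proof. by have /andP[] := qc w; exact: le_trans. Qed.

Let c'_ge0 : 0 <= c'. Proof. by have /andP[] := qc'; exact: le_trans. Qed.

Let mm : measurable_fun [set: T] m. Proof. by case: m2. Qed.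
Let ms : measurable_fun [set: T] s. Proof. by case: s2. Qed.
Let mc := L1_measurable L1c.
Let mq := L1_measurable L1q.

Let mr : measurable_fun [set: T] (fun w => (1 + c w)^-1).
Proof.
apply: measurable_inv; first exact: measurable_funD.
by move=> w; rewrite gt_eqF// ltr_wpDr.
Qed.

Let v w := q w / (1 + c w) ^+ 2 - q' / (1 + c') ^+ 2.

Let mv : measurable_fun [set: T] v.
Proof.
apply: measurable_funB => //; apply: measurable_funM => //.
apply: measurable_inv; last by move=> w; rewrite expf_neq0// gt_eqF// ltr_wpDr.
by apply: measurable_funX; exact: measurable_funD.
Qed.

Let loo w := loo_increment a (m w) (s w) (c w) (q w).

Lemma measurable_loo : measurable_fun [set: T] loo.
Proof.
have mx : measurable_fun [set: T] (fun w => (a - m w) / (1 + c w)).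
  by apply: measurable_funM => //; exact: measurable_funB.
apply: measurable_funD; last by apply: measurable_funM => //; exact: measurable_funX.
by apply: measurable_funM => //; exact: measurable_funM.
Qed.

(** The fluctuation is at most 1 pointwise, and its second moment is controlled by the
    variances of the quadratic statistics. *)
Lemma mean_shrink_dist : L1 P (fun w => v w ^+ 2) /\
  \int[P]_w (v w ^+ 2) <= 10 * Num.min (tau ^+ 2 * q2) 1.
Proof.
have v1 w : v w ^+ 2 <= 1.
  by rewrite -real_normK ?num_real// expr_le1// shrink_sqr_dist_le1.
have L : L1 P (fun w => v w ^+ 2).
  apply: L1_le (L1_cst P 1); first exact: measurable_funX.
  by move=> w; rewrite ger0_norm ?sqr_ge0.
split=> //; rewrite minr_pMr// le_min; apply/andP; split.
  case: c2 q2' => _ Lc Ec [_ Lq Eq].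
  apply: (@le_trans _ _ (\int[P]_w (2 * (q w - q') ^+ 2 + 8 * (c w - c') ^+ 2))).
    apply: le_Ex => //; first by apply: L1D; exact: L1Z.
    move=> w; have := shrink_sqr_dist (qc w) qc'; rewrite -/(v w).
    rewrite -[v w ^+ 2]real_normK ?num_real// -[(q w - q') ^+ 2]real_normK ?num_real//.
    rewrite -[(c w - c') ^+ 2]real_normK ?num_real//.
    have := normr_ge0 (v w); have := normr_ge0 (q w - q'); have := normr_ge0 (c w - c').
    move: `|v w| `|q w - q'| `|c w - c'| => x y z z0 y0 x0 h.
    have : x ^+ 2 <= (y + 2 * z) ^+ 2 by rewrite ler_pXn2r// nnegrE; lra.
    have := sqr_ge0 (y - 2 * z); nra.
  by rewrite ExD ?ExZ//; [lra|exact: L1Z|exact: L1Z].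
rewrite mulr1 -[leRHS](Ex_cst P); apply: le_Ex => //; first exact: L1_cst.
by move=> w; rewrite (le_trans (v1 w))// ler1n.
Qed.

(** Integrate [loo_increment_sqr]; the constant is [5 * 10], where 10 is the one of
    [mean_shrink_dist]. *)
Lemma loo_variance : exists k, \int[P]_w (loo w - k) ^+ 2 <=
  50 * (a ^+ 4 * Num.min (tau ^+ 2 * q2) 1 + tau ^+ 2 * l4 + a ^+ 2 * (tau * l2)).
Proof.
exists (a ^+ 2 * (q' / (1 + c') ^+ 2)).
have [Lv Ev] := mean_shrink_dist.
case: m2 s2 m4 s4 => _ Lm2 Em2 [_ Ls2 Es2] [_ Lm4 Em4] [_ Ls4 Es4].
pose D w := 5 * (4 * a ^+ 2 * s w ^+ 2 + 2 * (m w ^+ 4 + s w ^+ 4)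
   + 4 * a ^+ 2 * m w ^+ 2 + m w ^+ 4 + a ^+ 4 * v w ^+ 2).
have LD : L1 P D by do ![apply: L1Z|apply: L1D|by []].
apply: (@le_trans _ _ (\int[P]_w D w)).
  apply: le_Ex => // [|w]; last exact: loo_increment_sqr.
  apply: L1_le LD => [|w].
    by apply: measurable_funX; apply: measurable_funB => //; exact: measurable_loo.
  by rewrite ger0_norm ?sqr_ge0//; exact: loo_increment_sqr.
rewrite /D !(ExZ, ExD); do ?[apply: L1Z|apply: L1D|by []].
have a2 : 0 <= a ^+ 2 := sqr_ge0 a.
have a4 : 0 <= a ^+ 4 by rewrite (exprM _ 2 2) sqr_ge0.
have := ler_wpM2l a4 Ev; have := ler_wpM2l a2 Em2; have := ler_wpM2l a2 Es2.
have t2l4 : 0 <= tau ^+ 2 * l4 by rewrite mulr_ge0// sqr_ge0.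
have tl2 : 0 <= a ^+ 2 * (tau * l2) := mulr_ge0 a2 (mulr_ge0 tau0 l20).
lra.
Qed.

Let chi w := 2 * (1 + c')^-1 * ((a - m w) * s w) + q' / (1 + c') ^+ 2 * (a - m w) ^+ 2.
Let u w := (1 + c w)^-1 - (1 + c')^-1.

Let loo_chi w : `|loo w - chi w| <=
  2 * (`|a| * (`|s w| * `|u w|) + `|m w * s w| * `|u w|) + 2 * (a ^+ 2 + m w ^+ 2) * `|v w|.
Proof. exact: loo_increment_dist. Qed.

Let u1 w : `|u w| <= 1. Proof. exact: shrink_dist_le1. Qed.
Let v1 w : `|v w| <= 1. Proof. exact: shrink_sqr_dist_le1. Qed.
Let uc w : `|u w| <= `|c w - c'|. Proof. exact: shrink_dist. Qed.
Let vc w : `|v w| <= `|q w - q'| + 2 * `|c w - c'|. Proof. exact: shrink_sqr_dist. Qed.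

Let B1 w := 3 * a ^+ 2 + 3 * m w ^+ 2 + 2 * s w ^+ 2.

Let loo_chi1 w : `|loo w - chi w| <= B1 w.
Proof.
apply: le_trans (loo_chi w) _; rewrite /B1.
have h1 : `|s w| * `|u w| <= `|s w| by rewrite ler_piMr.
have h2 : `|m w * s w| * `|u w| <= `|m w| * `|s w| by rewrite normrM ler_piMr// mulr_ge0.
have h3 : (a ^+ 2 + m w ^+ 2) * `|v w| <= a ^+ 2 + m w ^+ 2.
  by rewrite ler_piMr// addr_ge0 ?sqr_ge0.
have := ler_wpM2l (normr_ge0 a) h1.
rewrite -[a ^+ 2]real_normK ?num_real// -[m w ^+ 2]real_normK ?num_real// in h3 *.
rewrite -[s w ^+ 2]real_normK ?num_real//.
have := sqr_ge0 (`|a| - `|s w|); have := sqr_ge0 (`|m w| - `|s w|); nra.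
Qed.

Let LB1 : L1 P B1.
Proof.
case: m2 s2 => _ Lm2 _ [_ Ls2 _].
by do ![apply: L1D|apply: L1Z|by []]; exact: L1_cst.
Qed.

Let Lms : L1 P (fun w => m w * s w).
Proof. by case: m2 s2 => ? Lm _ [? Ls _]; exact: L1_mul_sqr. Qed.

Lemma L1_of_sqr f b : moment_le 2 f b -> L1 P f.
Proof.
move=> hf; have [mf _ _] := hf; have [L _] := moment2_norm hf.
by apply: L1_le L.
Qed.

Let Lm := L1_of_sqr m2.
Let Ls := L1_of_sqr s2.

Let Lams : L1 P (fun w => (a - m w) * s w).
Proof.
rewrite (_ : (fun w => _) = fun w => a * s w - m w * s w).
  by apply: L1B => //; exact: L1Z.
by apply/funext => w; rewrite mulrBl.
Qed.

Let Lam2 : L1 P (fun w => (a - m w) ^+ 2).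
Proof.
case: m2 => _ Lm2 _.
rewrite (_ : (fun w => _) = fun w => a ^+ 2 - 2 * a * m w + m w ^+ 2).
  by apply: L1D => //; apply: L1B; [exact: L1_cst|exact: L1Z].
by apply/funext => w; ring.
Qed.

Let Lchi : L1 P chi. Proof. by apply: L1D; exact: L1Z. Qed.

Let Ldist : L1 P (fun w => loo w - chi w).
Proof.
apply: L1_le LB1 => //; apply: measurable_funB; first exact: measurable_loo.
exact: L1_measurable Lchi.
Qed.

Lemma L1_loo : L1 P loo.
Proof.
rewrite (_ : loo = fun w => (loo w - chi w) + chi w); first exact: L1D.
by apply/funext => w; rewrite subrK.
Qed.

(** The mean of the increment when [c] and [q] are frozen at their expectations; it depends
    only on first and second moments of the statistics. *)
Definition frozen_mean := 2 * (1 + c')^-1 * (a * \int[P]_w s w - \int[P]_w (m w * s w))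
  + q' / (1 + c') ^+ 2 * (a ^+ 2 - 2 * a * \int[P]_w m w + \int[P]_w (m w ^+ 2)).

Let mean_chi : \int[P]_w chi w = frozen_mean.
Proof.
case: m2 => _ Lm2 _.
rewrite ExD ?ExZ//; [|exact: L1Z|exact: L1Z]; congr (_ * _ + _ * _).
  rewrite -ExZ// -ExB//; last exact: L1Z.
  by apply: eq_Rintegral => w _; rewrite mulrBl.
rewrite -ExZ// -[a ^+ 2](Ex_cst P) -ExB//; [|exact: L1_cst|exact: L1Z].
rewrite -ExD//; last by apply: L1B; [exact: L1_cst|exact: L1Z].
by apply: eq_Rintegral => w _; ring.
Qed.

(** Both bounds come from [loo_chi]: the first from [|u|, |v| <= 1] and second moments
    only, the second from [|u| <= |c - c'|], [|v| <= |q - q'| + 2 |c - c'|] and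
    Cauchy-Schwarz. *)
Lemma loo_mean : `|\int[P]_w loo w - frozen_mean| <=
  6 * Num.min (a ^+ 2 + tau * l2)
   (Num.sqrt q2 * (tau * a ^+ 2 + 2 * tau ^+ 2 * Num.sqrt l4
       + `|a| * (tau * Num.sqrt tau) * Num.sqrt l2)).
Proof.
case: (m2) (s2) (m4) (s4) => _ Lm2 Em2 [_ Ls2 Es2] [_ Lm4 Em4] [_ Ls4 Es4].
rewrite -mean_chi -ExB//; last exact: L1_loo.
apply: le_trans (norm_Ex Ldist) _.
rewrite minr_pMr// le_min; apply/andP; split.
  apply: (@le_trans _ _ (\int[P]_w B1 w)); first by apply: le_Ex => //; exact: L1_norm.
  rewrite /B1 !(ExZ, ExD, Ex_cst); do ?[apply: L1Z|apply: L1D|exact: L1_cst|by []].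
  have := sqr_ge0 a; have := mulr_ge0 tau0 l20; lra.
have ms2 : moment_le 2 (fun w => m w * s w) (tau ^+ 2 * l4).
  have hp w : (m w * s w) ^+ 2 <= 2^-1 * (m w ^+ 4 + s w ^+ 4).
    by have := sqr_ge0 (m w ^+ 2 - s w ^+ 2); nra.
  have Lp : L1 P (fun w => 2^-1 * (m w ^+ 4 + s w ^+ 4)) by apply: L1Z; exact: L1D.
  have mms : measurable_fun [set: T] (fun w => m w * s w) by exact: measurable_funM.
  have Lp2 : L1 P (fun w => (m w * s w) ^+ 2).
    by apply: L1_le Lp => [|w]; [exact: measurable_funX|rewrite ger0_norm ?sqr_ge0].
  split=> //; apply: le_trans (le_Ex Lp2 Lp hp) _.
  by rewrite ExZ ?ExD//; [lra|exact: L1D].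
have m22 : moment_le 2 (fun w => m w ^+ 2) (tau ^+ 2 * l4).
  have e w : (m w ^+ 2) ^+ 2 = m w ^+ 4 by rewrite -exprM.
  split; first exact: measurable_funX.
    by under eq_fun do rewrite e.
  by under eq_Rintegral do rewrite e.
have [Lsc Esc] := moment2_mul s2 c2.
have [Lmsc Emsc] := moment2_mul ms2 c2.
have [Lmc Emc] := moment2_mul m22 c2.
have [Lmq Emq] := moment2_mul m22 q2'.
have [Lc Ec] := moment2_norm c2.
have [Lq Eq] := moment2_norm q2'.
pose B2 w := 2 * `|a| * (`|s w| * `|c w - c'|) + 2 * (`|m w * s w| * `|c w - c'|)
  + (2 * a ^+ 2) * (`|q w - q'| + 2 * `|c w - c'|)
  + 2 * (`|m w ^+ 2| * `|q w - q'| + 2 * (`|m w ^+ 2| * `|c w - c'|)).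
have LB2 : L1 P B2 by do ![apply: L1D|apply: L1Z|by []].
apply: (@le_trans _ _ (\int[P]_w B2 w)).
  apply: le_Ex => //; first exact: L1_norm.
  move=> w; apply: le_trans (loo_chi w) _; rewrite /B2.
  rewrite (ger0_norm (sqr_ge0 (m w))).
  have h1 := ler_wpM2l (normr_ge0 a) (ler_wpM2l (normr_ge0 (s w)) (uc w)).
  have h2 := ler_wpM2l (normr_ge0 (m w * s w)) (uc w).
  have h3 := ler_wpM2l (addr_ge0 (sqr_ge0 a) (sqr_ge0 (m w))) (vc w).
  lra.
rewrite /B2 !(ExZ, ExD); do ?[apply: L1Z|apply: L1D|by []].
have t2 : Num.sqrt (tau ^+ 2) = tau by rewrite sqrtr_sqr ger0_norm.
have e1 := sqrtrM l2 tau0; have e2 x := sqrtrM x (sqr_ge0 tau).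
rewrite ?e1 !e2 t2 in Ec Eq Esc Emsc Emc Emq.
have a0 := normr_ge0 a; have a2 := sqr_ge0 a.
have := ler_wpM2l a0 Esc; have := ler_wpM2l a2 Ec; have := ler_wpM2l a2 Eq.
have := sqrtr_ge0 l2; have := sqrtr_ge0 l4; have := sqrtr_ge0 q2; have := sqrtr_ge0 tau.
move: (Num.sqrt l2) (Num.sqrt l4) (Num.sqrt q2) (Num.sqrt tau)
  Esc Emsc Emc Emq Ec Eq => y2 y4 yq yt.
move=> Esc Emsc Emc Emq Ec Eq t0 yq0 y40 y20.
have p1 : 0 <= tau ^+ 2 * (y4 * yq) := mulr_ge0 (sqr_ge0 tau) (mulr_ge0 y40 yq0).
have p2 : 0 <= `|a| * (yt * y2 * (tau * yq)) by rewrite !mulr_ge0.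
have p3 : 0 <= a ^+ 2 * (tau * yq) := mulr_ge0 a2 (mulr_ge0 tau0 yq0).
lra.
Qed.

End moments.

(** * Measurability and moments of random vectors *)

Section measurable_matrices.
Context d (T : measurableType d) (R : realType).

Lemma measurable_sumr I (r : seq I) (f : I -> T -> R) :
  (forall i, measurable_fun [set: T] (f i)) ->
  measurable_fun [set: T] (fun w => \sum_(i <- r) f i w).
Proof.
move=> mf; elim: r => [|i r IH].
  by under eq_fun do rewrite big_nil; exact: measurable_cst.
by under eq_fun do rewrite big_cons; exact: (measurable_funD (mf i) IH).
Qed.

Lemma measurable_prodr I (r : seq I) (f : I -> T -> R) :
  (forall i, measurable_fun [set: T] (f i)) ->
  measurable_fun [set: T] (fun w => \prod_(i <- r) f i w).
Proof.
move=> mf; elim: r => [|i r IH].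
  by under eq_fun do rewrite big_nil; exact: measurable_cst.
by under eq_fun do rewrite big_cons; exact: (measurable_funM (mf i) IH).
Qed.

Definition measurable_mx m n (f : T -> 'M[R]_(m, n)) :=
  forall i j, measurable_fun [set: T] (fun w => f w i j).

Lemma measurable_mx_cst m n (M : 'M[R]_(m, n)) : measurable_mx (fun=> M).
Proof. by move=> i j; exact: measurable_cst. Qed.

Lemma measurable_mxM m n k (f : T -> 'M[R]_(m, n)) (g : T -> 'M[R]_(n, k)) :
  measurable_mx f -> measurable_mx g -> measurable_mx (fun w => f w *m g w).
Proof.
move=> mf mg i j; under eq_fun do rewrite mxE.
by apply: measurable_sumr => l; exact: (measurable_funM (mf i l) (mg l j)).
Qed.

Lemma measurable_mxD m n (f g : T -> 'M[R]_(m, n)) :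
  measurable_mx f -> measurable_mx g -> measurable_mx (fun w => f w + g w).
Proof.
by move=> mf mg i j; under eq_fun do rewrite mxE; exact: (measurable_funD (mf i j) (mg i j)).
Qed.

Lemma measurable_mxZ m n (a : T -> R) (f : T -> 'M[R]_(m, n)) :
  measurable_fun [set: T] a -> measurable_mx f -> measurable_mx (fun w => a w *: f w).
Proof.
by move=> ma mf i j; under eq_fun do rewrite mxE; exact: (measurable_funM ma (mf i j)).
Qed.

Lemma measurable_mx_tr m n (f : T -> 'M[R]_(m, n)) :
  measurable_mx f -> measurable_mx (fun w => (f w)^T).
Proof. by move=> mf i j; under eq_fun do rewrite mxE; exact: mf. Qed.

Lemma measurable_det n (f : T -> 'M[R]_n) :
  measurable_mx f -> measurable_fun [set: T] (fun w => \det (f w)).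
Proof.
move=> mf; apply: measurable_sumr => s.
apply: (measurable_funM (f := fun=> _)); first exact: measurable_cst.
by apply: measurable_prodr => i; exact: mf.
Qed.

Lemma measurable_invmx n (f : T -> 'M[R]_n) :
  measurable_mx f -> (forall w, f w \in unitmx) -> measurable_mx (fun w => invmx (f w)).
Proof.
move=> mf fu i j.
have e w : invmx (f w) i j = (\det (f w))^-1 * cofactor (f w) j i.
  by rewrite /invmx fu !mxE.
under eq_fun do rewrite e.
have mV : measurable_fun [set: T] (fun w => (\det (f w))^-1).
  apply: measurable_inv; first exact: measurable_det.
  by move=> w; have := fu w; rewrite unitmxE unitfE.
have mC : measurable_fun [set: T] (fun w => cofactor (f w) j i).
  apply: (measurable_funM (f := fun=> _)); first exact: measurable_cst.
  apply: measurable_det => k l; under eq_fun do rewrite !mxE; exact: mf.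
exact: (measurable_funM mV mC).
Qed.

Lemma measurable_Gform n p (rho : 'I_n -> R) (A S : 'M[R]_p) alpha (f : T -> 'M[R]_(n, p)) :
  pdmx A -> measurable_mx f -> measurable_fun [set: T] (fun w => Gform rho A S alpha (f w)).
Proof.
move=> Apd mf.
have mW : measurable_mx (fun w => scaled_data rho (f w)).
  apply: measurable_mxZ; first exact: measurable_cst.
  by apply: measurable_mxM => //; exact: measurable_mx_cst.
have mE : measurable_mx (fun w => ridge_estimate A alpha (scaled_data rho (f w))).
  apply: measurable_mxM.
    apply: measurable_invmx => [|w]; last exact: ridge_unit.
    apply: measurable_mxD; last exact: measurable_mx_cst.
    by apply: measurable_mxM => //; exact: measurable_mx_tr.
  by apply: measurable_mxM; [exact: measurable_mx_tr|exact: measurable_mx_cst].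
under eq_fun do rewrite (GformE _ _ _ _ Apd).
have : measurable_mx (fun w => (ridge_estimate A alpha (scaled_data rho (f w)))^T
          *m (S *m ridge_estimate A alpha (scaled_data rho (f w)))).
  apply: measurable_mxM; first exact: measurable_mx_tr.
  by apply: measurable_mxM => //; exact: measurable_mx_cst.
by move/(_ 0 0).
Qed.

End measurable_matrices.

Section random_vector.
Context d (T : measurableType d) (R : realType) (P : probability T R) (p : nat).
Variables (Z : {RV P >-> p.-tuple R}) (S : 'M[R]_p) (bL bQ : nat -> \bar R).
Hypotheses (p0 : (0 < p)%N) (Zcov : centered_cov Z S) (Zmom : moment_bounds Z bL bQ).

Let x w := colvec (Z w).
Let l2 := fine (bL 2%N).
Let l4 := fine (bL 4%N).
Let q2 := fine (bQ 2%N).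

Lemma measurable_coord j : measurable_fun [set: T] (fun w => x w j 0).
Proof.
under eq_fun do rewrite mxE.
exact: (measurableT_comp (measurable_tnth j) (@measurable_funPT _ _ _ _ Z)).
Qed.

Lemma measurable_colvec : measurable_mx x.
Proof. by move=> i j; rewrite (ord1 j); exact: measurable_coord. Qed.

Lemma measurable_lin v : measurable_fun [set: T] (fun w => dot (x w) v).
Proof.
apply: measurable_mxM; last exact: measurable_mx_cst.
exact/measurable_mx_tr/measurable_colvec.
Qed.

Lemma measurable_quad M : measurable_fun [set: T] (fun w => dot (x w) (M *m x w)).
Proof.
apply: measurable_mxM; first exact/measurable_mx_tr/measurable_colvec.
by apply: measurable_mxM; [exact: measurable_mx_cst|exact: measurable_colvec].
Qed.

Lemma expectation_le_L1 (f : T -> R) (b : \bar R) : measurable_fun [set: T] f ->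
  (forall w, 0 <= f w) -> b \is a fin_num -> ('E_P[f] <= b)%E ->
  L1 P f /\ \int[P]_w f w <= fine b.
Proof.
move=> mf f0 bfin; rewrite unlock => h.
have Lf : L1 P f.
  apply/integrableP; split; first exact/measurable_EFinP.
  under eq_integral do rewrite /= ger0_norm//.
  rewrite (le_lt_trans h)// -ge0_fin_numE// (le_trans _ h)//.
  by apply: integral_ge0 => w _; rewrite lee_fin.
by split=> //; rewrite -lee_fin (fineK bfin) -(EFin_Ex Lf).
Qed.

Lemma moment_leZ k (f : T -> R) b c : 0 <= c ^+ k -> moment_le P k f b ->
  moment_le P k (fun w => c * f w) (c ^+ k * b).
Proof.
move=> ck [mf Lf Ef]; split.
- by apply: (measurable_funM (f := fun=> _)) mf; exact: measurable_cst.
- by under eq_fun do rewrite exprMn; exact: L1Z.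
- by under eq_Rintegral do rewrite exprMn; rewrite ExZ// ler_wpM2l.
Qed.

Lemma moment_le_trans k (f : T -> R) b b' : b <= b' -> moment_le P k f b ->
  moment_le P k f b'.
Proof. by move=> bb' [mf Lf Ef]; split=> //; exact: le_trans bb'. Qed.

Lemma unit_linear_moment k v : (k == 2%N) || (k == 4%N) -> enorm v = 1 ->
  moment_le P k (fun w => dot (x w) v) (fine (bL k)).
Proof.
move=> k24 v1; case: Zmom => hL _ [f2 f4 _] _.
have bfin : bL k \is a fin_num by case/orP: k24 => /eqP ->.
have k0 : (1 <= k)%N by case/orP: k24 => /eqP ->.
have ek w : `|dot (x w) v| ^+ k = dot (x w) v ^+ k.
  by rewrite -normrX ger0_norm//; case/orP: k24 => /eqP ->; rewrite exprn_even_ge0.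
have := hL k v k0 v1; rewrite /= => h.
have mN : measurable_fun [set: T] (fun w => `|dot (x w) v| ^+ k).
  by apply: measurable_funX; exact: (measurableT_comp (@normr_measurable R _) (measurable_lin v)).
have N0 w : 0 <= `|dot (x w) v| ^+ k by rewrite exprn_ge0.
have [Lk Ek] := expectation_le_L1 mN N0 bfin h.
split; first exact: measurable_lin.
  by move: Lk; under eq_fun do rewrite ek.
by move: Ek; under eq_Rintegral do rewrite ek.
Qed.

Lemma even_moment_ge0 k (f : T -> R) b : ~~ odd k -> moment_le P k f b -> 0 <= b.
Proof.
by move=> k2 [_ _]; apply: le_trans; apply: Ex_ge0 => w; rewrite exprn_even_ge0.
Qed.

Lemma unit_vector : exists v : 'cV[R]_p, enorm v = 1.
Proof.
exists (delta_mx (Ordinal p0) 0).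
rewrite enormE /dot trmx_delta mul_delta_mx_cond eqxx mulr1n mxE !eqxx/=.
exact: sqrtr1.
Qed.

Lemma bL_ge0 k : (k == 2%N) || (k == 4%N) -> 0 <= fine (bL k).
Proof.
move=> k24; have [v v1] := unit_vector.
by apply: even_moment_ge0 (unit_linear_moment k24 v1); case/orP: k24 => /eqP ->.
Qed.

(** The moment bounds are homogeneous in the direction, so they extend from unit vectors
    to all vectors. *)
Lemma linear_moment k v tau : (k == 2%N) || (k == 4%N) -> dot v v <= tau ->
  moment_le P k (fun w => dot (x w) v) (tau ^+ k./2 * fine (bL k)).
Proof.
move=> k24 vt.
have ke : k = (k./2 * 2)%N by case/orP: k24 => /eqP ->.
have k2 : ~~ odd k by case/orP: k24 => /eqP ->.
have nn : enorm v ^+ k = dot v v ^+ k./2 by rewrite -enorm2 -exprM mulnC -ke.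
apply: (@moment_le_trans _ _ (enorm v ^+ k * fine (bL k))).
  rewrite ler_wpM2r ?bL_ge0// nn ler_pXn2r// ?nnegrE ?dot_ge0//.
    by case/orP: k24 => /eqP ->.
  exact: le_trans (dot_ge0 v) vt.
have [->|v0] := eqVneq v 0.
  have [u u1] := unit_vector.
  have := moment_leZ (c := 0) _ (unit_linear_moment k24 u1).
  rewrite enorm0; under eq_fun do rewrite mul0r.
  under [fun w => dot _ 0]eq_fun do rewrite dotC dot0l.
  by apply; rewrite exprn_even_ge0.
have e0 : enorm v != 0 by rewrite enorm_eq0.
have u1 : enorm ((enorm v)^-1 *: v) = 1.
  by rewrite enormZ ger0_norm ?invr_ge0 ?enorm_ge0// mulVf.
rewrite (_ : (fun w => _) = fun w => enorm v * dot (x w) ((enorm v)^-1 *: v)).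
  by apply: moment_leZ (unit_linear_moment k24 u1); rewrite exprn_even_ge0.
by apply/funext => w; rewrite dotZr mulrA mulfV// mul1r.
Qed.

(** Coordinates are linear forms, hence square integrable by the second moment bound. *)
Lemma L1_coordM j k : L1 P (fun w => x w j 0 * x w k 0).
Proof.
have h i : moment_le P 2 (fun w => x w i 0) (1 * l2).
  have e w : dot (x w) (delta_mx i 0) = x w i 0.
    by rewrite dotC /dot trmx_delta -rowE mxE.
  have := @linear_moment 2 (delta_mx i 0) 1 isT.
  under eq_fun do rewrite e.
  by rewrite expr1; apply; rewrite /dot trmx_delta mul_delta_mx_cond eqxx mulr1n mxE !eqxx.
have [mj Lj _] := h j; have [mk Lk _] := h k.
exact: L1_mul_sqr.
Qed.

Lemma Ex_coordM j k : \int[P]_w (x w j 0 * x w k 0) = S j k.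
Proof.
case: Zcov => Z0 /(_ j k); rewrite covariance.unlock !Z0/= => h.
apply: EFin_inj; rewrite -h -(EFin_Ex (L1_coordM j k)) [in RHS]unlock.
apply: eq_integral => w _; congr EFin; rewrite /= !mxE.
by rewrite -[LHS]/(_ * _) -[in LHS](subr0 (tnth (Z w) j)) -[in LHS](subr0 (tnth (Z w) k)).
Qed.

Lemma L1_sum I (r : seq I) (f : I -> T -> R) : (forall i, L1 P (f i)) ->
  L1 P (fun w => \sum_(i <- r) f i w).
Proof.
move=> Lf; elim: r => [|i r IH].
  by under eq_fun do rewrite big_nil; exact: L1_cst.
by under eq_fun do rewrite big_cons; exact: L1D.
Qed.

Lemma Ex_sum I (r : seq I) (f : I -> T -> R) : (forall i, L1 P (f i)) ->
  \int[P]_w (\sum_(i <- r) f i w) = \sum_(i <- r) \int[P]_w f i w.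
Proof.
move=> Lf; elim: r => [|i r IH].
  by under eq_Rintegral do rewrite big_nil; rewrite big_nil Ex_cst.
under eq_Rintegral do rewrite big_cons.
by rewrite big_cons ExD ?IH//; exact: L1_sum.
Qed.

Lemma quadE M w : dot (x w) (M *m x w) = \sum_j \sum_k M j k * (x w j 0 * x w k 0).
Proof.
rewrite dotE; apply: eq_bigr => j _; rewrite [(M *m _) j 0]mxE mulr_sumr.
by apply: eq_bigr => k _; rewrite mulrCA.
Qed.

Lemma L1_quad M : L1 P (fun w => dot (x w) (M *m x w)).
Proof.
under eq_fun do rewrite quadE.
by apply: L1_sum => j; apply: L1_sum => k; apply: L1Z; exact: L1_coordM.
Qed.

Definition quad_mean (M : 'M[R]_p) := \sum_j \sum_k M j k * S j k.

Lemma Ex_quad M : \int[P]_w dot (x w) (M *m x w) = quad_mean M.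
Proof.
under eq_Rintegral do rewrite quadE.
have L j k : L1 P (fun w => M j k * (x w j 0 * x w k 0)) by apply: L1Z; exact: L1_coordM.
rewrite Ex_sum => [|j]; last exact: L1_sum.
apply: eq_bigr => j _; rewrite Ex_sum//.
by apply: eq_bigr => k _; rewrite ExZ ?Ex_coordM//; exact: L1_coordM.
Qed.

Lemma linM_quad h k w : dot (x w) h * dot (x w) k = dot (x w) (h *m k^T *m x w).
Proof. by rewrite dot_mx_dot dotZr mulrC (dotC k). Qed.

Lemma Ex_linM h k : \int[P]_w (dot (x w) h * dot (x w) k) = quad_mean (h *m k^T).
Proof. by under eq_Rintegral do rewrite linM_quad; exact: Ex_quad. Qed.

Lemma Ex_lin v : \int[P]_w dot (x w) v = 0.
Proof.
have L j : L1 P (fun w => x w j 0).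
  apply: (L1_of_sqr (b := 1 * l2)).
  have e w : dot (x w) (delta_mx j 0) = x w j 0.
    by rewrite dotC /dot trmx_delta -rowE mxE.
  have := @linear_moment 2 (delta_mx j 0) 1 isT.
  under eq_fun do rewrite e.
  by rewrite expr1; apply; rewrite /dot trmx_delta mul_delta_mx_cond eqxx mulr1n mxE !eqxx.
have L' j : L1 P (fun w => v j 0 * x w j 0) by exact: L1Z.
under eq_Rintegral do rewrite dotC dotE.
rewrite Ex_sum// big1// => j _; rewrite ExZ//.
apply/eqP; rewrite mulf_eq0; apply/orP; right; apply/eqP.
case: Zcov => /(_ j) h _; apply: EFin_inj; rewrite -(EFin_Ex (L j)).
apply: etrans h; rewrite unlock.
by apply: eq_integral => w _; rewrite /= mxE.
Qed.

Lemma unit_quadratic_moment M : psdmx M -> opnorm M <= 1 ->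
  moment_le P 2 (fun w => dot (x w) (M *m x w) - \int[P]_w dot (x w) (M *m x w)) q2.
Proof.
move=> M0 M1; case: Zmom => _ hQ [_ _ fQ] _.
set f := fun w => dot (x w) (M *m x w); have Lf : L1 P f by exact: L1_quad.
have mf : measurable_fun [set: T] (fun w => f w - \int[P]_w f w).
  by apply: measurable_funB; [exact: measurable_quad|exact: measurable_cst].
have := hQ 2%N M isT M0 M1; rewrite /=.
have fE : (fun w => ((x w)^T *m M *m x w) 0 0) = f.
  by apply/funext => w; rewrite /f /dot mulmxA.
rewrite -/x [X in fine 'E_P[X]]fE (expectation_Ex Lf)/= => h.
have mN : measurable_fun [set: T] (fun w => `|f w - \int[P]_w f w| ^+ 2).
  by apply: measurable_funX; exact: (measurableT_comp (@normr_measurable R _) mf).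
have N0 w : 0 <= `|f w - \int[P]_w f w| ^+ 2 by rewrite exprn_ge0.
have h' : ('E_P[(fun w => `|f w - \int[P]_w f w| ^+ 2)%R] <= bQ 2%N)%E.
  apply: le_trans h; rewrite le_eqVlt; apply/orP; left; apply/eqP; congr expectation.
  by apply/funext => w; rewrite /f /dot mulmxA.
have [Lk Ek] := expectation_le_L1 mN N0 fQ h'.
have ew w : `|f w - \int[P]_w f w| ^+ 2 = (f w - \int[P]_w f w) ^+ 2.
  by rewrite real_normK ?num_real.
split=> //.
  by move: Lk; under eq_fun do rewrite ew.
by move: Ek; under eq_Rintegral do rewrite ew.
Qed.

Lemma q2_ge0 : 0 <= q2.
Proof.
apply: even_moment_ge0 (unit_quadratic_moment (M := 0) _ _) => //.
  by split=> [|v]; rewrite ?trmx0// mulmx0 mul0mx mxE.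
apply: psdmx_opnorm_le => // [|v]; last by rewrite mul0mx dotC dot0l mul1r dot_ge0.
by split=> [|v]; rewrite ?trmx0// mulmx0 mul0mx mxE.
Qed.

(** Homogeneity again: [M / tau] has operator norm at most 1. *)
Lemma quadratic_moment M tau : 0 < tau -> psdmx M ->
  (forall v, dot v (M *m v) <= tau * dot v v) ->
  moment_le P 2 (fun w => dot (x w) (M *m x w) - \int[P]_w dot (x w) (M *m x w)) (tau ^+ 2 * q2).
Proof.
move=> t0 M0 Mt; pose N := tau^-1 *: M.
have N0 : psdmx N.
  split=> [|v]; first by rewrite /N linearZ/= M0.1.
  by rewrite -scalemxAr -scalemxAl mxE mulr_ge0 ?invr_ge0 ?(ltW t0)//; exact: M0.2.
have N1 : opnorm N <= 1.
  apply: psdmx_opnorm_le => // v.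
  by rewrite -scalemxAl dotZr mul1r mulrC ler_pdivrMr// mulrC.
have := moment_leZ (c := tau) (sqr_ge0 _) (unit_quadratic_moment N0 N1).
have eN w : dot (x w) (N *m x w) = tau^-1 * dot (x w) (M *m x w).
  by rewrite -scalemxAl dotZr.
under eq_Rintegral do rewrite eN.
rewrite ExZ; last exact: L1_quad.
congr (moment_le P 2 _ _); apply/funext => w.
by rewrite eN -mulrBr mulrA mulfV ?mul1r// gt_eqF.
Qed.

Section increment.
Variables (h k : 'cV[R]_p) (C Q : 'M[R]_p) (tau : R).
Hypotheses (tau0 : 0 < tau) (ht : dot h h <= tau) (kt : dot k k <= tau).
Hypotheses (C0 : psdmx C) (Q0 : psdmx Q) (Ct : forall v, dot v (C *m v) <= tau * dot v v).
Hypothesis QC : forall v, dot v (Q *m v) <= dot v (C *m v).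

Let Qt v : dot v (Q *m v) <= tau * dot v v.
Proof. exact: le_trans (QC v) (Ct v). Qed.

Let qc w : 0 <= dot (x w) (Q *m x w) <= dot (x w) (C *m x w).
Proof. by rewrite psdmx_dot ?QC. Qed.

Definition vec_increment a w := loo_increment a (dot (x w) h) (dot (x w) k)
  (dot (x w) (C *m x w)) (dot (x w) (Q *m x w)).

Lemma increment_variance a : exists c, \int[P]_w (vec_increment a w - c) ^+ 2 <=
  50 * (a ^+ 4 * Num.min (tau ^+ 2 * q2) 1 + tau ^+ 2 * l4 + a ^+ 2 * (tau * l2)).
Proof.
have l20 : 0 <= l2 by exact: bL_ge0.
have l40 : 0 <= l4 by exact: bL_ge0.
apply: (loo_variance a (ltW tau0) l20 l40 qc).
- exact: (linear_moment (k := 2) isT ht).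
- exact: (linear_moment (k := 2) isT kt).
- exact: (linear_moment (k := 4) isT ht).
- exact: (linear_moment (k := 4) isT kt).
- exact: L1_quad.
- exact: L1_quad.
- exact: quadratic_moment.
- exact: quadratic_moment.
Qed.

(** [frozen_mean] computed from the covariance [S]: any two centered vectors with the same
    covariance share it, which is what makes the replacement argument work. The two zeros stand for
    the means of the linear statistics. *)
Definition frozen_mean_cov a :=
  2 * (1 + quad_mean C)^-1 * (a * 0 - quad_mean (h *m k^T))
  + quad_mean Q / (1 + quad_mean C) ^+ 2 * (a ^+ 2 - 2 * a * 0 + quad_mean (h *m h^T)).

Lemma increment_mean a : `|\int[P]_w vec_increment a w - frozen_mean_cov a| <=
  6 * Num.min (a ^+ 2 + tau * l2)
   (Num.sqrt q2 * (tau * a ^+ 2 + 2 * tau ^+ 2 * Num.sqrt l4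
       + `|a| * (tau * Num.sqrt tau) * Num.sqrt l2)).
Proof.
have l20 : 0 <= l2 by exact: bL_ge0.
have := @loo_mean _ _ _ P (fun w => dot (x w) h) (fun w => dot (x w) k)
  (fun w => dot (x w) (C *m x w)) (fun w => dot (x w) (Q *m x w)) a tau l2 l4 q2 (ltW tau0) l20 qc.
rewrite /frozen_mean !Ex_quad !Ex_lin Ex_linM.
under [\int[P]_w (dot (x w) h ^+ 2)]eq_Rintegral do rewrite expr2.
rewrite Ex_linM -/(frozen_mean_cov a); apply.
- exact: (linear_moment (k := 2) isT ht).
- exact: (linear_moment (k := 2) isT kt).
- exact: (linear_moment (k := 4) isT ht).
- exact: (linear_moment (k := 4) isT kt).
- exact: L1_quad.
- exact: L1_quad.
- by have := quadratic_moment tau0 C0 Ct; rewrite Ex_quad.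
- by have := quadratic_moment tau0 Q0 Qt; rewrite Ex_quad.
Qed.

Lemma L1_increment a : L1 P (vec_increment a).
Proof.
apply: (L1_loo (l2 := l2) a qc).
- exact: (linear_moment (k := 2) isT ht).
- exact: (linear_moment (k := 2) isT kt).
- exact: L1_quad.
- exact: L1_quad.
Qed.

End increment.

End random_vector.

(** * Bounds along one observation *)

(** The risk is linear in [Se], so it suffices to treat matrices below [A]. When
    [bA A Se = 0] the form of [Se] is nonpositive, hence [Se = 0]. *)
Lemma psdmx_normalize (R : realType) p (A Se : 'M[R]_p.+1) : pdmx A -> psdmx Se ->
  exists S : 'M[R]_p.+1, [/\ psdmx S, forall v, dot v (S *m v) <= dot v (A *m v) &
    Se = bA A Se *: S].
Proof.
move=> Apd Se0; set b := bA A Se; have b0 : 0 <= b := bA_ge0 A Se.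
have hb v : dot v (Se *m v) <= b * dot v (A *m v) := dot_le_bA Se v Apd.
have A0 v : 0 <= dot v (A *m v).
  apply: psdmx_dot; split=> [|u]; first exact: Apd.1.
  have [->|u0] := eqVneq u 0; first by rewrite mulmx0 mxE.
  exact/ltW/Apd.2.
have [bz|bnz] := eqVneq b 0.
  exists 0; split.
  - by split=> [|v]; rewrite ?trmx0// mulmx0 mul0mx mxE.
  - by move=> v; rewrite mul0mx dotC dot0l.
  rewrite scaler0; apply/matrixP => i j; rewrite [RHS]mxE.
  have Sv v : dot v (Se *m v) = 0.
    by apply/eqP; rewrite eq_le psdmx_dot// andbT (le_trans (hb v))// bz mul0r.
  have /eqP := psdmx_cauchy_schwarz (Se *m delta_mx j 0) (delta_mx j 0) Se0.
  move/eqP; rewrite !Sv mulr0 => h.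
  have : dot (Se *m delta_mx j 0) (Se *m delta_mx j 0) == 0.
    by rewrite -sqrf_eq0 eq_le h sqr_ge0.
  by rewrite dot_eq0 -colE => /eqP/matrixP/(_ i 0); rewrite !mxE.
have bp : 0 < b by rewrite lt0r bnz.
exists (b^-1 *: Se); split.
- split=> [|v]; first by rewrite linearZ/= Se0.1.
  by rewrite -scalemxAr -scalemxAl mxE mulr_ge0 ?invr_ge0//; exact: Se0.2.
- by move=> v; rewrite -scalemxAl dotZr mulrC ler_pdivrMr// mulrC.
- by rewrite scalerA mulfV// scale1r.
Qed.

Section assembly.
Context d (T : measurableType d) (R : realType) (P : probability T R) (n p : nat).
Variables (rho : 'I_n -> R) (A S : 'M[R]_p) (t : R) (alpha : 'cV[R]_n).
Hypotheses (p0 : (0 < p)%N) (rho0 : forall i, 0 < rho i).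
Hypotheses (Apd : pdmx A) (t0 : 0 < t) (tA : loewner_le t%:M A).
Hypotheses (S0 : psdmx S) (SA : forall v, dot v (S *m v) <= dot v (A *m v)).
Hypothesis alpha1 : dot alpha alpha <= 1.

Definition tuple_mx (z : n.-tuple (p.-tuple R)) : 'M[R]_(n, p) :=
  \matrix_(i, j) tnth (tnth z i) j.

Definition Gtuple (z : n.-tuple (p.-tuple R)) := Gform rho A S alpha (tuple_mx z).

Lemma bounded_meas_Gtuple : bounded_meas Gtuple.
Proof.
split.
  apply: measurable_Gform => // i j; under eq_fun do rewrite mxE.
  exact: (measurableT_comp (measurable_tnth j) (measurable_tnth i)).
exists 1 => z; rewrite ger0_norm; last exact: Gform_ge0.
exact: Gform_le1 Apd t0 tA SA alpha1 _.
Qed.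

Lemma tuple_mx_update z i y : tuple_mx (update z i y) = set_row (tuple_mx z) i (colvec y).
Proof.
apply/matrixP => k j; rewrite !mxE tnth_mktuple; case: eqP => // _; by rewrite !mxE.
Qed.

Lemma tuple_mx_joint (Z : 'I_n -> {RV P >-> p.-tuple R}) w :
  tuple_mx (joint Z w) = data_mx Z w.
Proof. by apply/matrixP => i j; rewrite !mxE tnth_mktuple. Qed.

(** Upper bound for the squared norms and the operator norms of the coefficients of the
    leave-one-out expansion along observation [i]. *)
Definition tau i := rho i ^+ 2 / (n%:R * t).

Lemma n_gt0 (i : 'I_n) : 0 < n%:R :> R.
Proof. by rewrite ltr0n (leq_ltn_trans _ (ltn_ord i)). Qed.

Lemma tau_gt0 i : 0 < tau i.
Proof. by rewrite divr_gt0 ?exprn_gt0// mulr_gt0// (n_gt0 i). Qed.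

Section one_vector.
Variables (Z : {RV P >-> p.-tuple R}) (bL bQ : nat -> \bar R).
Hypothesis (Zmom : moment_bounds Z bL bQ).

Lemma Gtuple_update_variance i z : exists c, \int[P]_w (Gtuple (update z i (Z w)) - c) ^+ 2 <=
  50 * (alpha i 0 ^+ 4 * Num.min (tau i ^+ 2 * fine (bQ 2%N)) 1
        + tau i ^+ 2 * fine (bL 4%N) + alpha i 0 ^+ 2 * (tau i * fine (bL 2%N))).
Proof.
have [g [h [k [C [Q [[ht kt] C0 [Q0 Ct] QC hG]]]]]] :=
  Gform_set_row rho Apd t0 tA S0 SA alpha1 (tuple_mx z) i.
have [c hc] := increment_variance p0 Zmom (tau_gt0 i) ht kt C0 Q0 Ct QC (alpha i 0).
exists (g + c); apply: le_trans hc; rewrite le_eqVlt; apply/orP; left; apply/eqP.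
apply: eq_Rintegral => w _; rewrite /Gtuple tuple_mx_update hG /vec_increment.
by congr (_ ^+ 2); ring.
Qed.

End one_vector.

Definition U2_min a ta l2 l4 q2 : R := Num.min (a ^+ 2 + ta * l2)
   (Num.sqrt q2 * (ta * a ^+ 2 + 2 * ta ^+ 2 * Num.sqrt l4
       + `|a| * (ta * Num.sqrt ta) * Num.sqrt l2)).

(** The leave-one-out expansions of both vectors have the same coefficients, and the
    frozen means coincide because the covariances do. *)
Lemma Gtuple_update_mean (X Y : {RV P >-> p.-tuple R}) Sg bLX bQX bLY bQY i z :
  centered_cov X Sg -> centered_cov Y Sg ->
  moment_bounds X bLX bQX -> moment_bounds Y bLY bQY ->
  `|\int[P]_w Gtuple (update z i (X w)) - \int[P]_w Gtuple (update z i (Y w))| <=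
  6 * U2_min (alpha i 0) (tau i) (fine (bLX 2%N)) (fine (bLX 4%N)) (fine (bQX 2%N))
  + 6 * U2_min (alpha i 0) (tau i) (fine (bLY 2%N)) (fine (bLY 4%N)) (fine (bQY 2%N)).
Proof.
move=> Xcov Ycov Xmom Ymom.
have [g [h [k [C [Q [[ht kt] C0 [Q0 Ct] QC hG]]]]]] :=
  Gform_set_row rho Apd t0 tA S0 SA alpha1 (tuple_mx z) i.
have E (Z : {RV P >-> p.-tuple R}) bL bQ : centered_cov Z Sg -> moment_bounds Z bL bQ ->
    \int[P]_w Gtuple (update z i (Z w)) = g + \int[P]_w vec_increment Z h k C Q (alpha i 0) w.
  move=> Zcov Zmom.
  have L := L1_increment p0 Zmom ht kt Q0 QC (alpha i 0).
  rewrite -[g in RHS](Ex_cst P) -ExD//; last exact: L1_cst.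
  by apply: eq_Rintegral => w _; rewrite /Gtuple tuple_mx_update hG.
rewrite (E _ _ _ Xcov Xmom) (E _ _ _ Ycov Ymom).
have hX := increment_mean p0 Xcov Xmom (tau_gt0 i) ht kt C0 Q0 Ct QC (alpha i 0).
have hY := increment_mean p0 Ycov Ymom (tau_gt0 i) ht kt C0 Q0 Ct QC (alpha i 0).
set eX := \int[P]_w _ in hX *; set eY := \int[P]_w _ in hY *.
have -> : g + eX - (g + eY) = (eX - frozen_mean_cov Sg h k C Q (alpha i 0))
   - (eY - frozen_mean_cov Sg h k C Q (alpha i 0)) by ring.
by rewrite (le_trans (ler_normB _ _))// lerD.
Qed.

Lemma Vbound_ge (a b : R) i l2 l4 q2 : 0 <= l2 -> 0 <= l4 -> 0 <= q2 ->
  b ^+ 2 * (50 * (a ^+ 4 * Num.min (tau i ^+ 2 * q2) 1 + tau i ^+ 2 * l4 + a ^+ 2 * (tau i * l2)))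
  <= Vbound n 50 b t a (rho i) l2 l4 q2.
Proof.
move=> l20 l40 q20; have n0 := n_gt0 i; rewrite /Vbound.
have -> : rho i ^+ 4 / n%:R ^+ 2 * (q2 / t ^+ 2) = tau i ^+ 2 * q2.
  by rewrite /tau; field; rewrite !gt_eqF.
have -> : rho i ^+ 4 / n%:R ^+ 2 * (l4 / t ^+ 2) = tau i ^+ 2 * l4.
  by rewrite /tau; field; rewrite !gt_eqF.
have -> : a ^+ 2 * (rho i ^+ 2 / n%:R) * (l2 / t) = a ^+ 2 * (tau i * l2).
  by rewrite /tau; field; rewrite !gt_eqF.
rewrite [50 * b ^+ 2]mulrC -[leRHS]mulrA ler_wpM2l ?sqr_ge0// ler_pM2l// -!addrA lerD2l lerDr.
rewrite le_min ler01 andbT !addr_ge0//.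
- have -> : a ^+ 4 * (rho i ^+ 4 / n%:R ^+ 2) * (q2 / t ^+ 2) = a ^+ 4 * (tau i ^+ 2 * q2).
    by rewrite /tau; field; rewrite !gt_eqF.
  by rewrite mulr_ge0 ?exprn_even_ge0// mulr_ge0// sqr_ge0.
- by rewrite mulr_ge0// sqr_ge0.
- exact: mulr_ge0 (sqr_ge0 a) (mulr_ge0 (ltW (tau_gt0 i)) l20).
Qed.

Lemma U1bound_ge0 (b : R) i a l2 l4 q2 : 0 <= b ->
  0 <= U1bound n 50 b t a (rho i) l2 l4 q2.
Proof.
move=> b0; have n0 := n_gt0 i; have r0 := ltW (rho0 i).
rewrite /U1bound; apply: mulr_ge0; [apply: mulr_ge0|apply: addr_ge0].
- by rewrite mulr_ge0// divr_ge0// sqrtr_ge0.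
- by rewrite le_min ler01 andbT !mulr_ge0 ?invr_ge0 ?sqrtr_ge0 ?exprn_ge0.
- by rewrite !mulr_ge0 ?invr_ge0 ?sqrtr_ge0.
- by rewrite !mulr_ge0 ?invr_ge0 ?sqrtr_ge0 ?exprn_ge0// ltW.
Qed.

(** In terms of [tau], both arguments of the minimum in [U2bound] are those of
    [U2_min]. *)
Lemma U2bound_ge (a b : R) i l2 l4 q2 : 0 <= b -> 0 <= l2 -> 0 <= q2 ->
  b * (6 * U2_min a (tau i) l2 l4 q2) <= U2bound n 50 b t a (rho i) l2 l4 q2.
Proof.
move=> b0 l20 q20; have n0 := n_gt0 i.
have sn : 0 < Num.sqrt (n%:R : R) by rewrite sqrtr_gt0.
have st : 0 < Num.sqrt t by rewrite sqrtr_gt0.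
have en : n%:R = Num.sqrt (n%:R : R) ^+ 2 by rewrite sqr_sqrtr// ltW.
have et : t = Num.sqrt t ^+ 2 by rewrite sqr_sqrtr// ltW.
have eq : Num.sqrt (q2 / n%:R) = Num.sqrt q2 / Num.sqrt n%:R.
  by rewrite sqrtrM// sqrtrV// ltW.
have etau : Num.sqrt (tau i) = rho i / (Num.sqrt n%:R * Num.sqrt t).
  rewrite /tau {1}en {1}et -exprMn -expr_div_n sqrtr_sqr ger0_norm//.
  by rewrite divr_ge0 ?(ltW (rho0 i))// mulr_ge0// ltW.
rewrite /U2bound /U2_min.
have -> : a ^+ 2 + rho i ^+ 2 / n%:R * (l2 / t) = a ^+ 2 + tau i * l2.
  by rewrite /tau; field; rewrite !gt_eqF.
have -> : Num.sqrt (q2 / n%:R) *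
     (rho i ^+ 2 / Num.sqrt n%:R
        * (a ^+ 2 / t + rho i ^+ 2 / n%:R * (t ^+ 2)^-1 * Num.sqrt l4)
      + (t * Num.sqrt t)^-1
        * (rho i ^+ 4 / (n%:R * Num.sqrt n%:R) * (Num.sqrt t)^-1 * Num.sqrt l4
           + `|a| * rho i ^+ 3 / n%:R * Num.sqrt l2)) =
   Num.sqrt q2 * (tau i * a ^+ 2 + 2 * tau i ^+ 2 * Num.sqrt l4
       + `|a| * (tau i * Num.sqrt (tau i)) * Num.sqrt l2).
  rewrite eq etau /tau.
  move: (Num.sqrt n%:R) (Num.sqrt t) sn st en et => s u s0 u0 -> ->.
  by field; rewrite !gt_eqF.
set mn := Num.min _ _; have mn0 : 0 <= mn.
  have ta0 := ltW (tau_gt0 i).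
  rewrite le_min; apply/andP; split.
    exact: addr_ge0 (sqr_ge0 a) (mulr_ge0 ta0 l20).
  apply: mulr_ge0; first exact: sqrtr_ge0.
  apply: addr_ge0; first apply: addr_ge0.
  - exact: mulr_ge0 ta0 (sqr_ge0 a).
  - apply: mulr_ge0 (sqrtr_ge0 l4); apply: mulr_ge0 (sqr_ge0 _) => //.
  - apply: mulr_ge0 (sqrtr_ge0 l2); apply: mulr_ge0 (normr_ge0 a) _.
    exact: mulr_ge0 ta0 (sqrtr_ge0 _).
rewrite [50 * b]mulrC -[leRHS]mulrA ler_wpM2l// ler_wpM2r//; lra.
Qed.

End assembly.

(** * Variance and mean comparison *)

Lemma variance_Ex d (T : measurableType d) (R : realType) (P : probability T R) (f : T -> R) :
  bounded_meas f -> variance P f = (\int[P]_w (f w - \int[P]_w' f w') ^+ 2)%:E.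
Proof.
move=> hf; rewrite /variance covariance.unlock (expectation_Ex (bounded_meas_L1 P hf))/=.
rewrite -EFin_Ex; last first.
  apply: bounded_meas_L1; apply: bounded_measX2; apply: bounded_measB => //.
  exact: bounded_meas_cst.
by rewrite unlock; apply: eq_integral.
Qed.

Theorem theorem3p8 (R : realType) :
  exists K : R, 0 < K /\
  forall (d : measure_display) (T : measurableType d) (P : probability T R)
    (c C : R) (n p : nat)
    (X Y : 'I_n -> {RV P >-> p.-tuple R})
    (Sigma : 'I_n -> 'M[R]_p)
    (bLX bQX bLY bQY : 'I_n -> nat -> \bar R)
    (rho : 'I_n -> R) (A Se : 'M[R]_p) (t : R) (alpha : 'cV[R]_n),
  0 < c -> c <= p%:R / n%:R -> p%:R / n%:R <= C ->
  mutually_independent X -> mutually_independent Y ->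
  independent_families X Y ->
  (forall j, centered_cov (X j) (Sigma j)) ->
  (forall j, centered_cov (Y j) (Sigma j)) ->
  (forall j, moment_bounds (X j) (bLX j) (bQX j)) ->
  (forall j, moment_bounds (Y j) (bLY j) (bQY j)) ->
  (forall i, 0 < rho i) ->
  pdmx A -> 0 < t -> loewner_le t%:M A ->
  psdmx Se ->
  enorm alpha = 1 ->
  let G (Z : 'I_n -> {RV P >-> p.-tuple R}) (w : T) :=
    Gform rho A Se alpha (data_mx Z w) in
  let at_i (B : nat -> R -> R -> R -> R -> R -> R -> R -> R -> R)
      (bL bQ : 'I_n -> nat -> \bar R) (i : 'I_n) : R :=
    B n K (bA A Se) t (alpha i 0) (rho i)
      (fine (bL i 2%N)) (fine (bL i 4%N)) (fine (bQ i 2%N)) in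
  (exists V : 'I_n -> R,
     (forall i, V i <= at_i (@Vbound R) bLX bQX i) /\
     (variance P (G X) <= (\sum_i V i)%:E)%E) /\
  (exists U1X U2X U1Y U2Y : 'I_n -> R,
     (forall i, U1X i <= at_i (@U1bound R) bLX bQX i) /\
     (forall i, U2X i <= at_i (@U2bound R) bLX bQX i) /\
     (forall i, U1Y i <= at_i (@U1bound R) bLY bQY i) /\
     (forall i, U2Y i <= at_i (@U2bound R) bLY bQY i) /\
     (`| 'E_P[fun w => (G X w - G Y w)%R] |
        <= (\sum_i (U1X i + U2X i + U1Y i + U2Y i))%:E)%E).
Proof.
(* 50 serves the variance; for the means 6 would do. *)
exists 50; split=> // d T P c C n p X Y Sigma bLX bQX bLY bQY rho A Se t alpha.
move=> c0 cpn _ Xindep Yindep XYindep Xcov Ycov Xmom Ymom rho0 Apd t0 tA Se0 alpha1.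
have p0 : (0 < p)%N.
  by rewrite lt0n; apply: contraTneq cpn => ->; rewrite mul0r -ltNge.
case: p p0 X Y Sigma A Se Xindep Yindep XYindep Xcov Ycov Xmom Ymom Apd tA Se0 cpn => // p p0
  X Y Sigma A Se Xindep Yindep XYindep Xcov Ycov Xmom Ymom Apd tA Se0 cpn G at_i.
have [S [S0 SA SeE]] := psdmx_normalize Apd Se0.
have al1 : dot alpha alpha <= 1 by rewrite -enorm2 alpha1 expr1n.
set b := bA A Se in SeE; have b0 : 0 <= b := bA_ge0 A Se.
pose F := Gtuple rho A S alpha.
have hF : bounded_meas F := bounded_meas_Gtuple rho Apd t0 tA S0 SA al1.
have GE Z w : G Z w = b * F (joint Z w).
  by rewrite /F /Gtuple tuple_mx_joint -GformZ -SeE.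
have LF Z : L1 P (fun w => F (joint Z w)) := L1_joint Z hF.
have EG Z : \int[P]_w G Z w = b * \int[P]_w F (joint Z w).
  by under eq_Rintegral do rewrite GE; exact: ExZ.
have hl2 (Z : {RV P >-> p.+1.-tuple R}) bL bQ : moment_bounds Z bL bQ -> 0 <= fine (bL 2%N).
  by move=> Zm; exact: (bL_ge0 (P := P) (Z := Z) p0 Zm (k := 2) isT).
have hl4 (Z : {RV P >-> p.+1.-tuple R}) bL bQ : moment_bounds Z bL bQ -> 0 <= fine (bL 4%N).
  by move=> Zm; exact: (bL_ge0 (P := P) (Z := Z) p0 Zm (k := 4) isT).
have hq2 (Z : {RV P >-> p.+1.-tuple R}) bL bQ : moment_bounds Z bL bQ -> 0 <= fine (bQ 2%N).
  by move=> Zm; exact: (q2_ge0 (P := P) (Z := Z) p0 Zm).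
split.
  pose v i := 50 * (alpha i 0 ^+ 4 * Num.min (tau rho t i ^+ 2 * fine (bQX i 2%N)) 1
        + tau rho t i ^+ 2 * fine (bLX i 4%N) + alpha i 0 ^+ 2 * (tau rho t i * fine (bLX i 2%N))).
  exists (fun i => b ^+ 2 * v i); split.
    move=> i; apply: Vbound_ge => //.
    - exact: hl2 (Xmom i).
    - exact: hl4 (Xmom i).
    - exact: hq2 (Xmom i).
  have hG : bounded_meas (G X).
    rewrite (_ : G X = fun w => b * F (joint X w)); last exact/funext.
    exact/bounded_measZ/bounded_meas_joint.
  rewrite variance_Ex// lee_fin EG -mulr_sumr.
  have es := efron_stein Xindep hF (fun i =>
    Gtuple_update_variance p0 rho0 Apd t0 tA S0 SA al1 (Xmom i) i).
  have hD : bounded_meas (fun z => (F z - \int[P]_w F (joint X w)) ^+ 2).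
    by apply: bounded_measX2; apply: bounded_measB => //; exact: bounded_meas_cst.
  apply: le_trans (ler_wpM2l (sqr_ge0 b) es); rewrite -(ExZ _ (L1_joint X hD)).
  rewrite le_eqVlt; apply/orP; left; apply/eqP.
  by apply: eq_Rintegral => w _; rewrite GE -mulrBr exprMn.
pose u bL bQ i := 6 * U2_min (alpha i 0) (tau rho t i) (fine (bL i 2%N : \bar R)) (fine (bL i 4%N))
   (fine (bQ i 2%N)).
(* The whole replacement error fits in the second family of bounds. *)
exists (fun=> 0), (fun i => b * u bLX bQX i), (fun=> 0), (fun i => b * u bLY bQY i).
split; first by move=> i; exact: U1bound_ge0.
split; first by move=> i; apply: U2bound_ge => //; [exact: hl2 (Xmom i)|exact: hq2 (Xmom i)].
split; first by move=> i; exact: U1bound_ge0.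
split; first by move=> i; apply: U2bound_ge => //; [exact: hl2 (Ymom i)|exact: hq2 (Ymom i)].
have li := lindeberg Xindep Yindep XYindep hF (fun i z =>
  Gtuple_update_mean p0 rho0 Apd t0 tA S0 SA al1 i z (Xcov i) (Ycov i) (Xmom i) (Ymom i)).
have LG Z : L1 P (G Z).
  rewrite (_ : G Z = fun w => b * F (joint Z w)); last exact/funext.
  exact: L1Z.
have EGXY : 'E_P[fun w => (G X w - G Y w)%R]%E
    = (b * (\int[P]_w F (joint X w) - \int[P]_w F (joint Y w)))%:E.
  apply: etrans (expectation_Ex (L1B (LG X) (LG Y))) _; congr EFin.
  by apply: etrans (ExB (LG X) (LG Y)) _; rewrite (EG X) (EG Y) mulrBr.
rewrite EGXY abse_EFin lee_fin normrM (ger0_norm b0).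
apply: le_trans (ler_wpM2l b0 li) _; rewrite mulr_sumr; apply: ler_sum => i _.
by rewrite !add0r addr0 mulrDr.
Qed.
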